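(* Let $J$ be a bounded self-adjoint Jacobi matrix (i.e. $a_j>0$ and $b_j\in\mathbb{R}$ for all $j\ge0$), let $\mu$ be the spectral measure of $J$ corresponding to $\delta_0$, and let $\Lambda(J)=(\nu,\psi)$ be the spectral data of $J$. Then $$\mathrm{d}\mu(s)=\frac{1+\psi(s)}{2}\,\mathrm{d}\nu(s),\quad s\ge0,$$ $$\mathrm{d}\widetilde\mu(s)=\frac{1-\psi(s)}{2}\,\mathrm{d}\nu(s),\quad s>0,$$ where $\widetilde\mu(\Delta):=\mu(-\Delta)$ for Borel $\Delta\subset\mathbb{R}$, $-\Delta=\{-x:x\in\Delta\}$.
   Context: Let $\delta_j$, $j\ge0$, be the standard basis of $\ell^2(\mathbb{N}_0)$, $\mathbb{N}_0=\{0,1,2,\dots\}$, and let $\langle\cdot,\cdot\rangle$ be the inner product of $\ell^2(\mathbb{N}_0)$, linear in the first argument. A Jacobi matrix with parameters $(a_j)_{j\ge0}$, $(b_j)_{j\ge0}$ is the infinite tridiagonal symmetric matrix $J$ with $J_{j,j}=b_j$, $J_{j,j+1}=J_{j+1,j}=a_j$ and all other entries zero. It is bounded if $\sup_{j\ge0}(|a_j|+|b_j|)<\infty$; it is then regarded as a bounded linear operator on $\ell^2(\mathbb{N}_0)$. We write $|J|=\sqrt{J^*J}$. For self-adjoint $J$, $\mu(\Delta)=\langle\chi_\Delta(J)\delta_0,\delta_0\rangle$ for Borel $\Delta\subset\mathbb{R}$. The spectral data of $J$ is the pair $\Lambda(J)=(\nu,\psi)$, where $\nu(\Delta)=\langle\chi_\Delta(|J|)\delta_0,\delta_0\rangle$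 is the spectral measure of $|J|$ corresponding to $\delta_0$, and $\psi$ is the unique element of $L^\infty(\nu)$ with $\psi(0)=1$, $|\psi(s)|\le1$ for $\nu$-a.e. $s\ge0$, and $\langle Jf(|J|)\delta_0,\delta_0\rangle=\int_0^\infty s f(s)\psi(s)\,\mathrm{d}\nu(s)$ for all $f\in C(\mathbb{R})$. The two displayed identities are equalities of the measures restricted to $[0,\infty)$ and $(0,\infty)$ respectively. *)

(* Defs.v *)
From HB Require Import structures.
From mathcomp Require Import all_boot all_order all_algebra.
From mathcomp Require Import all_classical all_reals all_analysis.
From mathcomp Require Import complex ring lra zify.

Set Implicit Arguments.
Unset Strict Implicit.
Unset Printing Implicit Defensive.

Import Order.TTheory GRing.Theory Num.Theory.
Import numFieldNormedType.Exports.
Import Normc.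

Local Open Scope classical_set_scope.
Local Open Scope ring_scope.
Local Open Scope complex_scope.

(* [Re], [Im] of real-closed's [R[i]], shadowed by those of [Num] *)
Local Notation Re := complex.Re.
Local Notation Im := complex.Im.

Section SquareSummable.
Context {R : realType}.

Definition square_summable : {pred nat -> R[i]^o} :=
  [pred x | `[< cvgn (series (fun n => normc (x n) ^+ 2)) >]].

Lemma square_summableP (x : nat -> R[i]) :
  reflect (cvgn (series (fun n => normc (x n) ^+ 2))) (x \in square_summable).
Proof. exact: asboolP. Qed.

Lemma normc_ge0 (z : R[i]) : 0 <= normc z.
Proof. by case: z => u v /=; exact: sqrtr_ge0. Qed.

Lemma square_summable_submod : submod_closed square_summable.
Proof.
split=> [|c x y /square_summableP cx /square_summableP cy].
  apply/square_summableP; rewrite (_ : series _ = cst 0); first exact: is_cvg_cst.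
  apply/funext => n; rewrite /series /= big1// => i _.
  by rewrite !expr0n /= addr0 sqrtr0 expr0n.
apply/square_summableP.
apply: (@series_le_cvg R _ (fun n => 2 * (normc c ^+ 2 * normc (x n) ^+ 2)
   + 2 * normc (y n) ^+ 2)) => [n|n|n|].
- exact: sqr_ge0.
- have := mulr_ge0 (sqr_ge0 (normc c)) (sqr_ge0 (normc (x n))).
  by have := sqr_ge0 (normc (y n)); lra.
- have le0 := normc_ge0 (c * x n + y n).
  have := le_normcD (c * x n : Rcomplex R) (y n).
  rewrite [normc (c * x n)]normcM => le1.
  have le2 : normc (c * x n + y n) ^+ 2 <= (normc c * normc (x n) + normc (y n)) ^+ 2.
    by rewrite ler_pXn2r// nnegrE ?addr_ge0 ?mulr_ge0 ?normc_ge0.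
  apply: (le_trans le2); rewrite -exprMn.
  set p := _ * _; set q := normc (y n).
  rewrite -subr_ge0 (_ : _ - _ = (p - q) ^+ 2) ?sqr_ge0//.
  rewrite sqrrB sqrrD !mulr2n !mulrDl !mul1r.
  rewrite !opprD !addrA.
  by ring.
- apply: is_cvg_seriesD.
    by do 2!apply: (@is_cvg_seriesZ R); exact: cx.
  by apply: (@is_cvg_seriesZ R); exact: cy.
Qed.

End SquareSummable.

HB.instance Definition _ (R : realType) :=
  GRing.isSubmodClosed.Build R[i] (nat -> R[i]^o) (@square_summable R)
    (@square_summable_submod R).

Section L2.
Variable R : realType.

Record l2 := L2 {
  l2_seq :> nat -> R[i]^o ;
  _ : l2_seq \in @square_summable R }.

HB.instance Definition _ := [isSub for l2_seq].
HB.instance Definition _ := [Choice of l2 by <:].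
HB.instance Definition _ := [SubChoice_isSubLmodule of l2 by <:].

(* linear in the first argument; both series converge absolutely on [l2] *)
Definition inner (x y : l2) : R[i] :=
  limn (series (fun n => Re (x n * (y n)^*%C))) +i*
  limn (series (fun n => Im (x n * (y n)^*%C))).

Definition l2norm (x : l2) : R := Num.sqrt (Re (inner x x)).

Lemma delta_subproof (j : nat) :
  (fun n => (n == j)%:R : R[i]^o) \in @square_summable R.
Proof.
apply/square_summableP; apply/cvg_ex; exists 1.
apply: cvg_near_cst; exists j.+1 => // n /= jn.
rewrite /series /= (bigD1_seq j) ?mem_iota ?iota_uniq ?subn0 //= eqxx.
rewrite normc1 expr1n big1 ?addr0// => i /negbTE ->.
by rewrite normc0 expr0n.
Qed.

Definition delta (j : nat) : l2 := L2 (delta_subproof j).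


Definition bounded_operator (A : l2 -> l2) : Prop :=
  linear A /\ exists M : R, forall x, l2norm (A x) <= M * l2norm x.

Definition adjoint (A B : l2 -> l2) : Prop :=
  forall x y, inner (A x) y = inner x (B y).

Definition positive_operator (A : l2 -> l2) : Prop :=
  forall x, 0 <= inner (A x) x.

(* [P] is the positive square root of [A^* A]. *)
Definition is_abs_operator (A P : l2 -> l2) : Prop :=
  [/\ bounded_operator P, positive_operator P &
      exists2 Astar, adjoint A Astar & forall x, P (P x) = Astar (A x)].

Definition orthogonal_projection (P : l2 -> l2) : Prop :=
  [/\ linear P, forall x, P (P x) = P x & adjoint P P].

Definition jacobi_entry (a b : nat -> R[i]) (i j : nat) : R[i] :=
  if i == j then b j else if j == i.+1 then a i else
  if i == j.+1 then a j else 0.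

(* The rows of the matrix are finitely supported: row [i] vanishes beyond [i + 1]. *)
Definition jacobi_seq (a b : nat -> R[i]) (x : nat -> R[i]) : nat -> R[i]^o :=
  fun i => \sum_(j < i.+2) jacobi_entry a b i j * x j.

Definition bounded_params (a b : nat -> R[i]) : Prop :=
  exists M : R, forall j, normc (a j) + normc (b j) <= M.

Definition jacobi (a b : nat -> R[i]) (x : l2) : l2 := insubd 0 (jacobi_seq a b x).

Lemma jacobi_seqE a b x i : jacobi_seq a b x i =
  (if i is k.+1 then a k * x k else 0) + b i * x i + a i * x i.+1.
Proof.
rewrite /jacobi_seq big_ord_recr big_ord_recr /= /jacobi_entry.
rewrite eqxx (ltn_eqF (ltnSn i)) eqxx; congr (_ + _ + _).
case: i => [|k]; first by rewrite big_ord0.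
rewrite big_ord_recr /= (gtn_eqF (ltnSn k)) eqxx.
rewrite (ltn_eqF (ltnW (ltnSn k.+1))) big1 ?add0r// => -[j /= jk] _.
by rewrite !ifF ?mul0r//; apply/negP => /eqP; lia.
Qed.

Lemma square_summable_mul (c x : nat -> R[i]) (M : R) :
  (forall n, normc (c n) <= M) -> x \in @square_summable R ->
  (fun n => c n * x n : R[i]^o) \in @square_summable R.
Proof.
move=> cM /square_summableP cx; apply/square_summableP.
apply: (@series_le_cvg R _ (fun n => M ^+ 2 * normc (x n) ^+ 2)) => [n|n|n|].
- exact: sqr_ge0.
- exact: (mulr_ge0 (sqr_ge0 _) (sqr_ge0 _)).
- rewrite normcM exprMn; apply: ler_wpM2r; first exact: sqr_ge0.
  have := cM n; have := normc_ge0 (c n); nra.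
- by apply: (@is_cvg_seriesZ R); exact: cx.
Qed.

Lemma square_summable_shiftl (x : nat -> R[i]) :
  x \in @square_summable R ->
  (fun n => x n.+1 : R[i]^o) \in @square_summable R.
Proof.
move=> /square_summableP /cvg_ex[l cx]; apply/square_summableP/cvg_ex.
exists (l - normc (x 0%N) ^+ 2).
rewrite (_ : series _ =
  (fun n => series (fun n => normc (x n) ^+ 2) n.+1 - normc (x 0%N) ^+ 2)).
  by apply: cvgB; [rewrite (cvg_shiftS (series _)); exact: cx|exact: cvg_cst].
apply/funext => n; rewrite /series /= big_nat_recl//.
by rewrite addrC addKr.
Qed.

Lemma square_summable_shiftr (x : nat -> R[i]) :
  x \in @square_summable R ->
  (fun n => (if n is k.+1 then x k else 0) : R[i]^o) \in @square_summable R.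
Proof.
move=> /square_summableP /cvg_ex[l cx]; apply/square_summableP/cvg_ex.
exists l; rewrite -cvg_shiftS.
rewrite (_ : (fun n => _) = series (fun n => normc (x n) ^+ 2)); first exact: cx.
apply/funext => n; rewrite /series /= big_nat_recl//=.
by rewrite !expr0n /= addr0 sqrtr0 expr0n add0r.
Qed.

(* The default value [0] of [jacobi] is never used for bounded parameters. *)
Lemma jacobiE a b x i : bounded_params a b ->
  jacobi a b x i = jacobi_seq a b x i.
Proof.
move=> [M abM].
have aM n : normc (a n) <= M.
  by apply: le_trans (abM n); rewrite lerDl normc_ge0.
have bM n : normc (b n) <= M.
  by apply: le_trans (abM n); rewrite lerDr normc_ge0.
rewrite /jacobi /insubd insubT //=.
rewrite (_ : jacobi_seq a b x =
  (fun n => (if n is k.+1 then a k * x k else 0) : R[i]^o) +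
  (fun n => b n * x n : R[i]^o) + (fun n => a n * x n.+1 : R[i]^o)); last first.
  by apply/funext => n; rewrite jacobi_seqE.
have xP : (x : nat -> R[i]) \in @square_summable R by case: (x).
apply: rpredD; [apply: rpredD|].
- exact/(@square_summable_shiftr (fun k => a k * x k))/(square_summable_mul aM xP).
- exact: square_summable_mul bM xP.
- exact: square_summable_mul aM (square_summable_shiftl xP).
Qed.

(* Projection-valued measures on the Borel sets of [R]; countable additivity is
   stated for the scalar measures $D \mapsto <E(D) x, x>$. *)
Record pvm := Pvm {
  pvm_op :> set (measurableTypeR R) -> l2 -> l2 ;
  pvm_proj : forall D, measurable D -> orthogonal_projection (pvm_op D) ;
  pvm_set0 : forall x, pvm_op set0 x = 0 ;
  pvm_setT : forall x, pvm_op setT x = x ;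
  pvm_setI : forall D D', measurable D -> measurable D' ->
    forall x, pvm_op (D `&` D') x = pvm_op D (pvm_op D' x) ;
  pvm_sigma_additive : forall x,
    semi_sigma_additive (fun D => (Re (inner (pvm_op D x) x))%:E) }.

Lemma Re_inner_ge0 (x : l2) : 0 <= Re (inner x x).
Proof.
have xP : (x : nat -> R[i]) \in @square_summable R by case: (x).
have ReE n : Re (x n * (x n)^*%C) = normc (x n) ^+ 2.
  case: (x n) => u v /=; rewrite sqr_sqrtr ?addr_ge0 ?sqr_ge0//.
  by rewrite mulrN opprK.
rewrite /= (_ : (fun n => _) = (fun n => normc (x n) ^+ 2)).
  apply: limr_ge; first exact/square_summableP.
  by apply: nearW => n; apply: sumr_ge0 => i _; exact: sqr_ge0.
by apply/funext => n; exact: ReE.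
Qed.

(* [measure_ge0] ranges over all sets, hence the value 0 on non-Borel sets. *)
Definition pvm_measure (E : pvm) (x : l2) (D : set (measurableTypeR R)) : \bar R :=
  if `[< measurable D >] then (Re (inner (E D x) x))%:E else 0%E.

Section PvmMeasure.
Variables (E : pvm) (x : l2).

Lemma pvm_measureE D : measurable D ->
  pvm_measure E x D = (Re (inner (E D x) x))%:E.
Proof. by move=> mD; rewrite /pvm_measure; case: asboolP. Qed.

Let pvm_measure0 : pvm_measure E x set0 = 0%E.
Proof.
rewrite pvm_measureE// pvm_set0 /= (_ : series _ = cst 0) ?lim_cst//.
apply/funext => n; rewrite /series /= big1// => i _.
by case: (x i) => u v /=; rewrite !mul0r subr0.
Qed.

Let pvm_measure_ge0 D : (0 <= pvm_measure E x D)%E.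
Proof.
rewrite /pvm_measure; case: asboolP => // mD; rewrite lee_fin.
have [_ idemP adjP] := pvm_proj E mD.
by rewrite -idemP adjP; exact: Re_inner_ge0.
Qed.

Let pvm_measure_sigma_additive : semi_sigma_additive (pvm_measure E x).
Proof.
move=> F mF tF mUF; rewrite pvm_measureE//.
rewrite (_ : (fun n => _) =
  (fun n => \sum_(0 <= i < n) (Re (inner (E (F i) x) x))%:E)%E).
  exact: (@pvm_sigma_additive E x F mF tF mUF).
by apply/funext => n; apply: eq_bigr => i _; rewrite pvm_measureE.
Qed.

HB.instance Definition _ := isMeasure.Build _ _ _ (pvm_measure E x)
  pvm_measure0 pvm_measure_ge0 pvm_measure_sigma_additive.

End PvmMeasure.

Local Notation measureR := {measure set (measurableTypeR R) -> \bar R}.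

Definition Cintegrable (m : measureR) (D : set (measurableTypeR R)) (f : R -> R[i]) : Prop :=
  m.-integrable D (fun s => (Re (f s))%:E) /\
  m.-integrable D (fun s => (Im (f s))%:E).

Definition Cintegral (m : measureR) (D : set (measurableTypeR R)) (f : R -> R[i]) : R[i] :=
  (\int[m]_(s in D) Re (f s)) +i* (\int[m]_(s in D) Im (f s)).

(* [T] is the operator $\int f dE$; by polarization it is determined by its
   quadratic form. *)
Definition is_pvm_integral (E : pvm) (f : R -> R[i]) (T : l2 -> l2) : Prop :=
  bounded_operator T /\ forall x,
    Cintegrable (pvm_measure E x) setT f /\
    inner (T x) x = Cintegral (pvm_measure E x) setT f.

(* [E] is the spectral resolution $A = \int s dE(s)$ of the bounded self-adjoint
   [A], so that $\chi_D(A)$ is [E D] and $f(A)$ is the [T] such that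
   [is_pvm_integral E f T]. *)
Definition spectral_resolution (A : l2 -> l2) (E : pvm) : Prop :=
  is_pvm_integral E (fun s => s%:C) A.

Definition is_spectral_measure_of (E : pvm) (v : l2) (m : measureR) : Prop :=
  forall D, measurable D -> m D \is a fin_num /\ (fine (m D))%:C = inner (E D v) v.

Definition is_spectral_measure (A : l2 -> l2) (v : l2) (m : measureR) : Prop :=
  exists2 E, spectral_resolution A E & is_spectral_measure_of E v m.

(* [psi] is a representative of a class in $L^\infty(\nu)$, chosen with [psi 0 = 1]. *)
Definition is_spectral_data (A : l2 -> l2) (nu : measureR) (psi : R -> R[i]) : Prop :=
  exists P E,
    [/\ is_abs_operator A P, spectral_resolution P E,
        is_spectral_measure_of E (delta 0) nu &
    [/\ measurable_fun setT (fun s : measurableTypeR R => Re (psi s)) /\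
        measurable_fun setT (fun s : measurableTypeR R => Im (psi s)),
        psi 0 = 1,
        {ae nu, forall s : measurableTypeR R, 0 <= (s : R) -> normc (psi s) <= 1} &
        forall (f : R -> R[i]) (T : l2 -> l2), continuous (f : R -> R[i]^o) ->
          is_pvm_integral E f T ->
          inner (A (T (delta 0))) (delta 0) =
          Cintegral nu `[0, +oo[ (fun s => s%:C * f s * psi s)]].

Definition has_density_on (I : set R) (m : set (measurableTypeR R) -> \bar R)
    (nu : measureR) (g : R -> R[i]) : Prop :=
  forall D : set (measurableTypeR R), measurable D -> D `<=` I ->
    [/\ m D \is a fin_num, Cintegrable nu D g &
        (fine (m D))%:C = Cintegral nu D g].

Definition reflected (m : set (measurableTypeR R) -> \bar R) (D : set (measurableTypeR R)) :=
  m [set - (x : R) | x in D].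

End L2.

(* Main.v *)
Require Import Defs.
From HB Require Import structures.
From mathcomp Require Import all_boot all_order all_algebra.
From mathcomp Require Import all_classical all_reals all_analysis.
From mathcomp Require Import measurable_realfun.
From mathcomp Require Import complex ring lra.

Set Implicit Arguments.
Unset Strict Implicit.
Unset Printing Implicit Defensive.

Import Order.TTheory GRing.Theory Num.Theory.
Import numFieldNormedType.Exports.
Import Normc.

Local Open Scope classical_set_scope.
Local Open Scope ring_scope.
Local Open Scope complex_scope.

Local Notation Re := complex.Re.
Local Notation Im := complex.Im.

(** Write A for the self-adjoint operator, P for its modulus, mu and nu for the
    spectral measures of A and P at the vector v. The functional calculus gives
    the moments of the two measures. Since P^2 = A^2,
      int s^(2k) dmu = <A^(2k) v, v> = <P^(2k) v, v> = int s^(2k) dnu,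
    and the defining property of psi, read for the monomial f(s) = s^(2k), gives
      int s^(2k+1) dmu = <A P^(2k) v, v> = int_[0,oo) s^(2k+1) psi(s) dnu.
    Measures of bounded support with equal even moments have the same image under
    the absolute value. The first identity says that this image of mu is nu;
    the second that the image of the signed measure s dmu is s psi(s) dnu. On the
    half-line, 2 s dmu = (s + |s|) dmu, hence s dmu = s (1 + psi(s)) / 2 dnu, and
    s can be divided out on (0,oo). At the point 0 the two measures have the same
    mass, and psi(0) = 1. The formula for the reflected measure follows by
    subtraction, because nu is the sum of mu and its reflection on (0,oo).
    Taking imaginary parts in the second identity shows that psi is real nu-almost everywhere.

    Two points need an argument of their own.

    Moments (spectral_moment). A projection-valued measure E resolving A is only
    known through the quadratic form <A x, x> = int s d<E x, x>. Applying this to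
    the compressions E(D) x shows that A commutes with E(D), and that the measures
    of x + A x and x - A x differ by 4 s times the measure of x. By polarization
    <A^(n+1) x, x> is a quarter of the difference of the n-th moments of these two
    measures, and the formula for all powers follows by induction. The bound on
    the norms of the A^n x then bounds the supports.

    Determination by even moments (even_moments_determine). The polynomials
    (1 - y^n)^k, with k of order n / t^n, are bounded by 1 on [0,1) and converge
    there to the indicator function of y < t. Evaluated at a multiple of s^2 they
    give the integrals over the sets |s| < t by dominated convergence, and the
    pi-lambda theorem gives the others. *)

(** * The inner product of l2 *)

Section ComplexSeries.
Variable R : realType.
Implicit Types z w : nat -> R[i].

Definition csummable z :=
  cvgn (series (fun n => Re (z n))) /\ cvgn (series (fun n => Im (z n))).

(** The inner product of x and y unfolds to the csum of the products of x n with
    the conjugate of y n, so its algebra is that of convergent series. *)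
Definition csum z : R[i] :=
  limn (series (fun n => Re (z n))) +i* limn (series (fun n => Im (z n))).

Lemma cReD (c d : R[i]) : Re (c + d) = Re c + Re d.
Proof. by case: c; case: d. Qed.

Lemma cImD (c d : R[i]) : Im (c + d) = Im c + Im d.
Proof. by case: c; case: d. Qed.

Lemma cReN (c : R[i]) : Re (- c) = - Re c.
Proof. by case: c. Qed.

Lemma cImN (c : R[i]) : Im (- c) = - Im c.
Proof. by case: c. Qed.

Lemma cReM (c d : R[i]) : Re (c * d) = Re c * Re d - Im c * Im d.
Proof. by case: c; case: d. Qed.

Lemma cImM (c d : R[i]) : Im (c * d) = Re c * Im d + Im c * Re d.
Proof. by case: c; case: d. Qed.

Lemma csumD z w : csummable z -> csummable w ->
  csum (fun n => z n + w n) = csum z + csum w.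
Proof.
move=> [zr zi] [wr wi]; rewrite /csum.
have eqR : series (fun n => Re (z n + w n)) =
    series (fun n => Re (z n)) \+ series (fun n => Re (w n)).
  apply/funext => n; rewrite /series /= -big_split /=.
  by apply: eq_bigr => i _; rewrite cReD.
have eqI : series (fun n => Im (z n + w n)) =
    series (fun n => Im (z n)) \+ series (fun n => Im (w n)).
  apply/funext => n; rewrite /series /= -big_split /=.
  by apply: eq_bigr => i _; rewrite cImD.
by rewrite eqR eqI !limD.
Qed.

Lemma csumZ (c : R[i]) z : csummable z ->
  csum (fun n => c * z n) = c * csum z.
Proof.
move=> [zr zi]; rewrite /csum; case: c => u v.
have eqR : series (fun n => Re ((u +i* v) * z n)) =
    (u \*: series (fun n => Re (z n))) \- (v \*: series (fun n => Im (z n))).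
  apply/funext => n; rewrite /series /= !scaler_sumr -sumrB.
  by apply: eq_bigr => i _; rewrite cReM.
have eqI : series (fun n => Im ((u +i* v) * z n)) =
    (u \*: series (fun n => Im (z n))) \+ (v \*: series (fun n => Re (z n))).
  apply/funext => n; rewrite /series /= !scaler_sumr -big_split /=.
  by apply: eq_bigr => i _; rewrite cImM.
rewrite eqR eqI; congr (_ +i* _); apply/cvg_lim => //.
  by apply: cvgB; apply: cvgZl_tmp.
by apply: cvgD; apply: cvgZl_tmp.
Qed.

Lemma csumJ z : csummable z -> csum (fun n => (z n)^*) = (csum z)^*.
Proof.
move=> [zr zi]; rewrite /csum /=; congr (_ +i* _).
  by congr (limn (series _)); apply/funext => n; case: (z n).
have -> : series (fun n => Im (z n)^*) = \- series (fun n => Im (z n)).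
  apply/funext => n; rewrite /series /= -sumrN.
  by apply: eq_bigr => i _; case: (z i).
by apply/cvg_lim => //; exact: cvgN.
Qed.

End ComplexSeries.

Section LinearMaps.
Variable R : realType.
Notation H := (l2 R).
Variable A : H -> H.
Hypothesis linA : linear A.

Lemma linearMD x y : A (x + y) = A x + A y.
Proof. by rewrite -[in LHS](scale1r x) linA scale1r. Qed.

Lemma linearM0 : A 0 = 0.
Proof.
have := linearMD 0 0; rewrite addr0 => /eqP.
by rewrite -subr_eq0 opprD addrA subrr sub0r oppr_eq0 => /eqP.
Qed.

Lemma linearMZ c x : A (c *: x) = c *: A x.
Proof. by rewrite -[in LHS](addr0 (c *: x)) linA linearM0 addr0. Qed.

Lemma linearMB x y : A (x - y) = A x - A y.
Proof. by rewrite linearMD -scaleN1r linearMZ scaleN1r. Qed.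

Lemma linear_iter n : linear (iter n A).
Proof. by elim: n => [//|n IH] c x y; rewrite !iterS IH linA. Qed.

Lemma adjoint_iter n : adjoint A A -> adjoint (iter n A) (iter n A).
Proof.
move=> symA; elim: n => [//|n IH] x y.
by rewrite iterS symA IH -iterSr.
Qed.

End LinearMaps.

Local Arguments inner : simpl never.

Section InnerProduct.
Variable R : realType.
Notation H := (l2 R).
Implicit Types (x y z : H) (c : R[i]).

Lemma l2D x y n : (x + y : H) n = x n + y n. Proof. by []. Qed.
Lemma l2Z c x n : (c *: x : H) n = c * x n. Proof. by []. Qed.

Lemma normc_sqr (c : R[i]) : normc c ^+ 2 = Re c ^+ 2 + Im c ^+ 2.
Proof. by case: c => u v /=; rewrite sqr_sqrtr ?addr_ge0 ?sqr_ge0. Qed.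

(** Both parts of a product are at most the sum of the squared moduli. *)
Lemma inner_summable x y : csummable (fun n => x n * (y n)^*).
Proof.
have xP : (x : nat -> R[i]) \in @square_summable R by case: (x).
have yP : (y : nat -> R[i]) \in @square_summable R by case: (y).
have cxy : cvgn (series (fun n => normc (x n) ^+ 2 + normc (y n) ^+ 2)).
  by apply: is_cvg_seriesD; exact/square_summableP.
split; apply: normed_cvg; apply: (series_le_cvg _ _ _ cxy) => n /=.
- exact: normr_ge0.
- by rewrite addr_ge0 ?sqr_ge0.
- rewrite !normc_sqr; case: (x n) (y n) => a b [c d] /=.
  have := (sqr_ge0 (a - c), sqr_ge0 (a + c), sqr_ge0 (b - d), sqr_ge0 (b + d)).
  by move=> [[[h1 h2] h3] h4]; rewrite ler_norml; apply/andP; split; nra.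
- exact: normr_ge0.
- by rewrite addr_ge0 ?sqr_ge0.
- rewrite !normc_sqr; case: (x n) (y n) => a b [c d] /=.
  have := (sqr_ge0 (a - d), sqr_ge0 (a + d), sqr_ge0 (b - c), sqr_ge0 (b + c)).
  by move=> [[[h1 h2] h3] h4]; rewrite ler_norml; apply/andP; split; nra.
Qed.

Lemma innerE x y : inner x y = csum (fun n => x n * (y n)^*).
Proof. by []. Qed.

Lemma innerC x y : inner y x = (inner x y)^*.
Proof.
rewrite !innerE -csumJ; last exact: inner_summable.
by congr csum; apply/funext => n; rewrite rmorphM /= conjcK mulrC.
Qed.

Lemma innerDl x y z : inner (x + y) z = inner x z + inner y z.
Proof.
rewrite !innerE -csumD; try exact: inner_summable.
by congr csum; apply/funext => n; rewrite l2D mulrDl.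
Qed.

Lemma innerZl c x y : inner (c *: x) y = c * inner x y.
Proof.
rewrite !innerE -csumZ; last exact: inner_summable.
by congr csum; apply/funext => n; rewrite l2Z mulrA.
Qed.

Lemma innerDr x y z : inner x (y + z) = inner x y + inner x z.
Proof. by rewrite innerC innerDl (innerC y x) (innerC z x) rmorphD. Qed.

Lemma innerZr c x y : inner x (c *: y) = c^* * inner x y.
Proof. by rewrite innerC innerZl (innerC y x) rmorphM. Qed.

Lemma innerNl x y : inner (- x) y = - inner x y.
Proof. by rewrite -scaleN1r innerZl mulN1r. Qed.

Lemma innerNr x y : inner x (- y) = - inner x y.
Proof. by rewrite innerC innerNl (innerC y x) rmorphN. Qed.

Lemma innerBl x y z : inner (x - y) z = inner x z - inner y z.
Proof. by rewrite innerDl innerNl. Qed.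

Lemma innerBr x y z : inner x (y - z) = inner x y - inner x z.
Proof. by rewrite innerDr innerNr. Qed.

Lemma inner0l y : inner 0 y = 0.
Proof. by rewrite -(scale0r (0 : H)) innerZl mul0r. Qed.

Lemma inner0r y : inner y 0 = 0.
Proof. by rewrite innerC inner0l conjc0. Qed.

Lemma Im_innerxx x : Im (inner x x) = 0.
Proof.
have := innerC x x; case: (inner x x) => u v /= [] /eqP.
by rewrite -subr_eq0 opprK -mulr2n mulrn_eq0 /= => /eqP.
Qed.

Lemma inner_xxE x : inner x x = (Re (inner x x))%:C.
Proof. by have := Im_innerxx x; case: (inner x x) => u v /= ->. Qed.

Lemma Re_innerC x y : Re (inner y x) = Re (inner x y).
Proof. by rewrite innerC; case: (inner x y). Qed.

Lemma inner_eq0 x : Re (inner x x) = 0 -> x = 0.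
Proof.
move=> x0; apply: val_inj; apply/funext => n /=.
apply: (@eq0_normc R); apply/eqP; rewrite -sqrf_eq0.
rewrite -[_ == _]/(_ == _ :> R).
rewrite eq_le sqr_ge0 andbT -x0 /=.
have [xr _] := inner_summable x x.
have nd : nondecreasing_seq (series (fun n => Re (x n * (x n)^*))).
  apply/nondecreasing_seqP => m; rewrite seriesSr lerDl.
  by case: (x m) => u v /=; nra.
apply: le_trans (nondecreasing_cvgn_le nd xr n.+1).
rewrite seriesSr normc_sqr; set s := series _ n.
have : 0 <= s.
  by apply: sumr_ge0 => i _; case: (x i) => u v /=; nra.
case: (x n) => u v /=; nra.
Qed.

Lemma inner_inj x y : (forall z, inner z x = inner z y) -> x = y.
Proof.
move=> xy; apply/eqP; rewrite -subr_eq0; apply/eqP/inner_eq0.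
by rewrite innerBr xy subrr.
Qed.

Lemma l2norm_sqr x : l2norm x ^+ 2 = Re (inner x x).
Proof. by rewrite sqr_sqrtr // Re_inner_ge0. Qed.

(** Polarization over the complex field: testing the reality of the form on
    x + y and on ix + y gives both parts of the symmetry relation. *)
Lemma adjoint_of_real_form (A : H -> H) : linear A ->
  (forall x, Im (inner (A x) x) = 0) -> adjoint A A.
Proof.
move=> linA realA x y.
have im1 := realA (x + y); have im2 := realA ('i *: x + y).
move: im1 im2; rewrite !linearMD// linearMZ//.
rewrite !innerDl !innerDr !innerZl !innerZr.
rewrite (innerC (A y) x).
have := realA x; have := realA y.
case: (inner (A x) x) (inner (A y) y) (inner (A x) y) (inner (A y) x).
move=> a1 a2 [b1 b2] [c1 c2] [d1 d2] /= -> -> e1 e2; congr (_ +i* _); lra.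
Qed.

End InnerProduct.

(* Otherwise the arithmetic tactics compare inner products by unfolding them to
   limits of series. *)
#[local] Opaque inner.

(** * Densities of finite measures *)

Section Densities.
Context d (T : measurableType d) (R : realType).
Implicit Types (m : {finite_measure set T -> \bar R}) (D : set T) (f g : T -> R).

(** The Radon-Nikodym derivative, with finite values, together with the change of
    variables that it allows. *)
Lemma density_exists m1 m :
  (forall D, measurable D -> m D = 0%E -> m1 D = 0%E) ->
  exists h : T -> R, [/\ m.-integrable setT (EFin \o h),
    (forall D, measurable D -> fine (m1 D) = \int[m]_(s in D) h s) &
    forall f D, measurable D -> m1.-integrable D (EFin \o f) ->
      m.-integrable D (EFin \o (fun s => f s * h s)) /\
      \int[m1]_(s in D) f s = \int[m]_(s in D) (f s * h s)].
Proof.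
move=> m1m0.
have m1m : m1 `<< m by apply/null_content_dominatesP => D mD; exact: m1m0.
pose h : T -> \bar R := Radon_Nikodym_SigmaFinite.f m1 m.
have hE s : h s = (fine (h s))%:E.
  by rewrite fineK//; exact: Radon_Nikodym_SigmaFinite.f_fin_num.
have hfE : EFin \o (fine \o h) = h by apply/funext => s /=; rewrite -hE.
have ih : m.-integrable setT h by exact: Radon_Nikodym_SigmaFinite.f_integrable.
have mh : measurable_fun setT h by exact: measurable_int ih.
exists (fine \o h); split => [|D mD|f D mD if1].
- by rewrite hfE.
- rewrite /Rintegral; under eq_integral do rewrite /= -hE.
  by congr fine; exact: Radon_Nikodym_SigmaFinite.f_integral.
have fhE : EFin \o (fun s => f s * (fine \o h) s) = (fun s => (f s)%:E * h s)%E.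
  by apply/funext => s /=; rewrite EFinM -hE.
have mf : measurable_fun D (EFin \o f) by exact: measurable_int if1.
have if2 : m.-integrable D (fun s => (f s)%:E * h s)%E.
  have mfh : measurable_fun D (fun s => (f s)%:E * h s)%E.
    by apply: emeasurable_funM => //; exact: measurable_funTS.
  have := Radon_Nikodym_SigmaFinite.integrableM m1m
    (f := fun s => `|(f s)%:E|%E) (fun _ => abse_ge0 _) mD (integrable_abse if1).
  apply: le_integrable => // s Ds /=.
  by rewrite [X in (X <= _)%E]abseM [X in (_ <= X)%E]abseM /= normr_id.
split; first by rewrite fhE.
rewrite /Rintegral; congr fine.
under [RHS]eq_integral do rewrite EFinM -hE.
rewrite -(Radon_Nikodym_change_of_variables m1m mD if1); apply: ae_eq_integral => //.
- apply: emeasurable_funM => //; exact: measurable_funTS.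
- exact: measurable_int if2.
- by apply: ae_eqe_mul2l; apply/ae_eq_sym; exact: ae_eq_Radon_Nikodym_SigmaFinite.
Qed.

Lemma Rintegral_mulr_indic (m : {measure set T -> \bar R}) D f :
  \int[m]_s (f s * \1_D s) = \int[m]_(s in D) f s.
Proof.
rewrite [RHS]Rintegral_mkcond; apply: eq_Rintegral => s _.
by rewrite patchE indicE; case: (_ \in _); rewrite /= ?mulr1 ?mulr0.
Qed.

Lemma integrable_mulr_indic (m : {measure set T -> \bar R}) D f :
  measurable D -> m.-integrable setT (EFin \o f) ->
  m.-integrable setT (EFin \o (fun s => f s * \1_D s)).
Proof.
move=> mD intf; apply: le_integrable (intf) => //.
  apply/measurable_EFinP; apply: measurable_funM; last exact: measurable_indic.
  by apply/measurable_EFinP; exact: measurable_int intf.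
move=> s _ /=; rewrite lee_fin normrM ler_piMr// indicE.
by case: (_ \in _); rewrite /= ?normr1 ?normr0.
Qed.

Lemma ae_eq_integrable (m : {measure set T -> \bar R}) D (f g : T -> \bar R) :
  measurable D -> m.-integrable D f -> measurable_fun D g -> ae_eq m D f g ->
  m.-integrable D g.
Proof.
move=> mD /integrableP[mf foo] mg fg; apply/integrableP; split => //.
rewrite (@ae_eq_integral _ _ _ m D (abse \o f) (abse \o g)) //.
- exact: measurableT_comp.
- exact: measurableT_comp.
- by apply: filterS fg => s /= /[apply] ->.
Qed.

(** This is the change of density formula for the signed measure m1 - m2 = g m;
    it is how a product f(s) g(s) gets under the integral sign when only the
    values of measures are known. *)
Lemma integral_density_sub m1 m2 m g f :
  (forall D, measurable D -> m D = 0%E -> m1 D = 0%E) ->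
  (forall D, measurable D -> m D = 0%E -> m2 D = 0%E) ->
  m.-integrable setT (EFin \o g) ->
  (forall D, measurable D ->
     fine (m1 D) - fine (m2 D) = \int[m]_(s in D) g s) ->
  m1.-integrable setT (EFin \o f) -> m2.-integrable setT (EFin \o f) ->
  m.-integrable setT (EFin \o (fun s => f s * g s)) /\
  \int[m1]_s f s - \int[m2]_s f s = \int[m]_s (f s * g s).
Proof.
move=> m10 m20 ig m12 if1 if2.
have [h1 [ih1 m1E /(_ f setT measurableT if1)[ifh1 ->]]] := density_exists m10.
have [h2 [ih2 m2E /(_ f setT measurableT if2)[ifh2 ->]]] := density_exists m20.
have ih12 : m.-integrable setT (EFin \o (h1 \- h2)).
  rewrite (_ : _ \o _ = (EFin \o h1) \- (EFin \o h2))%E; last by apply/funext.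
  exact: integrableB.
have hg : ae_eq m setT (EFin \o (h1 \- h2)) (EFin \o g).
  apply: integral_ae_eq => //; first exact: measurable_int ig.
  move=> D _ mD.
  have iD k : m.-integrable setT (EFin \o k) -> m.-integrable D (EFin \o k).
    by move=> ik; apply: integrableS ik.
  have iDf k : m.-integrable setT (EFin \o k) ->
      (\int[m]_(s in D) (EFin \o k) s = (\int[m]_(s in D) k s)%:E)%E.
    by move=> /iD ik; rewrite fineK//; exact: integrable_fin_num.
  rewrite !iDf// -m12// m1E// m2E//; congr EFin.
  by apply: RintegralB => //; exact: iD.
have ifh : m.-integrable setT (EFin \o (fun s => f s * h1 s - f s * h2 s)).
  rewrite (_ : _ \o _ =
    (EFin \o (f \* h1)%R) \- (EFin \o (f \* h2)%R))%E; last by apply/funext.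
  exact: integrableB.
have mfg : measurable_fun setT (EFin \o (fun s => f s * g s)).
  apply/measurable_EFinP; apply: measurable_funM; apply/measurable_EFinP.
    exact: measurable_int if1.
  exact: measurable_int ig.
have fhg : ae_eq m setT (EFin \o (fun s => f s * h1 s - f s * h2 s))
    (EFin \o (fun s => f s * g s)).
  apply: filterS hg => s /= /(_ I) [hgs] _; congr EFin.
  by rewrite -mulrBr hgs.
split; first exact: ae_eq_integrable ifh mfg fhg.
rewrite -RintegralB //; congr fine; apply: ae_eq_integral => //.
exact: measurable_int ifh.
Qed.

End Densities.

Section BorelSets.
Variable R : realType.
Notation MR := (measurableTypeR R).

Lemma measurable_norm_ge (r : R) : measurable ([set s : R | r <= `|s|] : set MR).
Proof.
rewrite (_ : [set s | _] = `[r, +oo[%classic `|` `]-oo, (- r)]%classic).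
  by apply: measurableU; exact: measurable_itv.
by apply/seteqP; split => s /=; rewrite !in_itv/= andbT ler_normr lerNr => /orP.
Qed.

Lemma measurable_lt0 : measurable ([set s : R | s < 0] : set MR).
Proof.
rewrite (_ : [set s | _] = `]-oo, (0 : R)[%classic); first exact: measurable_itv.
by apply/seteqP; split => s /=; rewrite in_itv.
Qed.

End BorelSets.

(** * Moments of a spectral resolution *)

Lemma pvm_measure_fin (R : realType) (E : pvm R) (x : l2 R) :
  fin_num_fun (pvm_measure E x).
Proof. by move=> D mD; rewrite pvm_measureE. Qed.

HB.instance Definition _ (R : realType) (E : pvm R) (x : l2 R) :=
  @Measure_isFinite.Build _ _ R (pvm_measure E x) (@pvm_measure_fin R E x).

Section Pvm.
Variables (R : realType) (E : pvm R).
Notation H := (l2 R).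
Notation Em := (pvm_measure E).
Implicit Types (D B : set (measurableTypeR R)) (x y : H).

Lemma pvm_linear D : measurable D -> linear (E D).
Proof. by move=> /(pvm_proj E)[]. Qed.

Lemma pvm_idem D x : measurable D -> E D (E D x) = E D x.
Proof. by move=> /(pvm_proj E)[]. Qed.

Lemma pvm_adjoint D : measurable D -> adjoint (E D) (E D).
Proof. by move=> /(pvm_proj E)[]. Qed.

Lemma fine_pvm_measure D x : measurable D ->
  fine (Em x D) = Re (inner (E D x) x).
Proof. by move=> mD; rewrite pvm_measureE. Qed.

Lemma pvm_measure_eq0 D x : measurable D -> E D x = 0 -> Em x D = 0%E.
Proof. by move=> mD x0; rewrite pvm_measureE// x0 inner0l. Qed.

Lemma pvm_eq0 D x : measurable D -> Em x D = 0%E -> E D x = 0.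
Proof.
move=> mD; rewrite pvm_measureE// => -[xD]; apply: inner_eq0.
by rewrite pvm_adjoint// pvm_idem// Re_innerC.
Qed.

(** Additivity of the scalar measures gives the identity for quadratic forms;
    then x - E D x - E (~ D) x is orthogonal to x and to both projections of x,
    so its norm is 0. *)
Lemma pvm_setC D x : measurable D -> E (~` D) x = x - E D x.
Proof.
move=> mD; have mC : measurable (~` D) by exact: measurableC.
set u := E D x; set v := E (~` D) x.
have total : Re (inner u x) + Re (inner v x) = Re (inner x x).
  rewrite -(fine_pvm_measure x mD) -(fine_pvm_measure x mC) -fineD//.
    rewrite -measureU// ?setUv ?fine_pvm_measure// ?pvm_setT//.
    by rewrite setICr.
  - exact: fin_num_measure.
  - exact: fin_num_measure.
have Dv : E D v = 0 by rewrite -pvm_setI// setICr pvm_set0.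
have Cu : E (~` D) u = 0 by rewrite -pvm_setI// setICl pvm_set0.
apply/esym/eqP; rewrite -subr_eq0; apply/eqP/inner_eq0.
have -> : inner (x - u - v) (x - u - v) = inner (x - u - v) x.
  rewrite (innerBr _ _ v) (innerBr _ x u) -(pvm_adjoint mD) -(pvm_adjoint mC).
  rewrite !(linearMB (pvm_linear mD)) !(linearMB (pvm_linear mC)).
  by rewrite !pvm_idem// Dv Cu !subr0 !subrr inner0l !subr0.
by rewrite !innerBl !cReD !cReN -total -addrA -opprD subrr.
Qed.

End Pvm.

Section SpectralMoments.
Variables (R : realType) (E : pvm R) (A : l2 R -> l2 R).
Notation H := (l2 R).
Notation Em := (pvm_measure E).
Hypothesis AE : spectral_resolution A E.
Implicit Types (D B : set (measurableTypeR R)) (x y : H).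

Let linA : linear A. Proof. by case: AE => -[]. Qed.

Lemma spectral_id_integrable x :
  (Em x).-integrable setT (EFin \o (id : R -> R)).
Proof. by have [_ /(_ x)[[]]] := AE. Qed.

Lemma spectral_form x : inner (A x) x = (\int[Em x]_s s)%:C.
Proof.
have [_ /(_ x)[_ ->]] := AE; rewrite /Cintegral; congr (_ +i* _).
by rewrite /Rintegral integral0.
Qed.

Lemma spectral_adjoint : adjoint A A.
Proof. by apply: adjoint_of_real_form => // x; rewrite spectral_form. Qed.

(** The measure of E D x is that of x restricted to D, so that compressing A to
    the range of E D restricts the integral to D. *)
Lemma spectral_form_restr D x : measurable D ->
  Re (inner (A (E D x)) (E D x)) = \int[Em x]_s (s * \1_D s).
Proof.
move=> mD.
(* The measure of the zero vector serves as the zero measure. *)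
have [||||||_ <-] := @integral_density_sub _ _ _
    (Em (E D x)) (Em 0) (Em x) \1_D id.
- move=> B mB x0; apply: pvm_measure_eq0 => //.
  rewrite -pvm_setI// setIC pvm_setI// (pvm_eq0 mB x0).
  exact: linearM0 (pvm_linear E mD).
- move=> B mB x0; apply: pvm_measure_eq0 => //.
  exact: linearM0 (pvm_linear E mB).
- exact: integrable_indic.
- move=> B mB; rewrite !fine_pvm_measure// inner0r subr0.
  rewrite -pvm_adjoint// -!pvm_setI//; last exact: measurableI.
  rewrite /Rintegral integral_indic//= setIAC setIid.
  by rewrite pvm_measureE//; exact: measurableI.
- exact: spectral_id_integrable.
- exact: spectral_id_integrable.
- have := spectral_form 0; rewrite inner0r => -[<-].
  by rewrite subr0 spectral_form.
Qed.

(** The form of x = u + v is an integral, which splits over D and its complement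
    into the forms of u and v, so that the cross terms cancel. In other words, A
    commutes with E D. *)
Lemma spectral_cross D u v : measurable D -> E D u = u -> E D v = 0 ->
  Re (inner (A u) v) = 0.
Proof.
move=> mD Du Dv; have mC : measurable (~` D) by exact: measurableC.
have DxE : E D (u + v) = u by rewrite (linearMD (pvm_linear E mD)) Du Dv addr0.
have CxE : E (~` D) (u + v) = v.
  by rewrite pvm_setC// DxE addrAC subrr add0r.
have iD B : measurable B ->
    (Em (u + v)).-integrable setT (EFin \o (fun s => s * \1_B s)).
  move=> mB; apply: integrable_mulr_indic => //.
  exact: spectral_id_integrable.
have := spectral_form_restr (u + v) mD; have := spectral_form_restr (u + v) mC.
rewrite DxE CxE => fv fu.
have : Re (inner (A (u + v)) (u + v)) =
    Re (inner (A u) u) + Re (inner (A v) v).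
  rewrite fu fv -RintegralD//; [|exact: iD..].
  rewrite spectral_form /=; apply: eq_Rintegral => s _.
  rewrite -mulrDr !indicE in_setC.
  by case: (_ \in _); rewrite /= ?addr0 ?add0r mulr1.
rewrite linearMD// !innerDl !innerDr !cReD.
rewrite (spectral_adjoint v u) [Re (inner v _)]Re_innerC.
move: (Re _) (Re _) (Re _) => p q r; lra.
Qed.

(** Hence null sets for x are null for A x, which makes the measures of x + A x
    and x - A x absolutely continuous with respect to that of x. *)
Lemma spectral_ker D x : measurable D -> E D x = 0 -> E D (A x) = 0.
Proof.
move=> mD x0; apply: inner_eq0.
rewrite pvm_adjoint// pvm_idem// Re_innerC -spectral_adjoint.
by apply: (spectral_cross mD) => //; rewrite pvm_idem.
Qed.

Lemma spectral_measure_mul D x : measurable D ->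
  Re (inner (E D x) (A x)) = \int[Em x]_s (s * \1_D s).
Proof.
move=> mD; rewrite -spectral_form_restr// -spectral_adjoint.
rewrite -[in LHS](subrK (E D x) x) addrC innerDr cReD.
rewrite [X in _ + X](spectral_cross mD) ?addr0 ?(linearMB (pvm_linear E mD))//.
- rewrite (linearMD (pvm_linear E mD)) (linearMB (pvm_linear E mD)).
  by rewrite !pvm_idem// subrr addr0.
- by rewrite pvm_idem.
- by rewrite !pvm_idem// subrr.
Qed.

Lemma pvm_measure_polar D x y : measurable D ->
  fine (Em (x + y) D) - fine (Em (x - y) D) = 4 * Re (inner (E D x) y).
Proof.
move=> mD; rewrite !fine_pvm_measure//.
rewrite (linearMD (pvm_linear E mD)) (linearMB (pvm_linear E mD)).
rewrite !innerDl !innerDr !innerNl !innerNr !cReD !cReN.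
rewrite (pvm_adjoint E mD y x) (Re_innerC (E D x) y).
move: (Re _) (Re _) (Re _) => p q r; ring.
Qed.

(** By polarization, with y = Ax, the moment of order n+1 of x is the difference
    of the moments of order n of x + Ax and x - Ax; the measures of these two
    vectors differ by 4s times the measure of x. *)
Lemma spectral_moment n x :
  (Em x).-integrable setT (EFin \o (fun s : R => s ^+ n)) /\
  inner (iter n A x) x = (\int[Em x]_s (s ^+ n))%:C.
Proof.
elim: n x => [|n IH] x.
  split; first exact: finite_measure_integrable_cst.
  rewrite /= Rintegral_cst// mul1r fine_pvm_measure//.
  by rewrite pvm_setT -inner_xxE.
have null D y : measurable D -> Em x D = 0%E -> (y = A x \/ y = - A x) ->
    Em (x + y) D = 0%E.
  move=> mD /(pvm_eq0 mD) x0 yE; apply: pvm_measure_eq0 => //.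
  rewrite (linearMD (pvm_linear E mD)) x0 add0r.
  have Ax0 := spectral_ker mD x0.
  case: yE => -> //; rewrite -scaleN1r (linearMZ (pvm_linear E mD)) Ax0.
  by rewrite scaler0.
have i4 : (Em x).-integrable setT (EFin \o (fun s : R => 4 * s)).
  rewrite (_ : _ \o _ = fun s : R => (4%:E * (EFin \o (id : R -> R)) s)%E)//.
  by apply: integrableZl => //; exact: spectral_id_integrable.
have [ip fp] := IH (x + A x); have [im fm] := IH (x - A x).
have [||||//|//|isn sn] := @integral_density_sub _ _ _
    (Em (x + A x)) (Em (x - A x)) (Em x) (fun s : R => 4 * s) (fun s => s ^+ n).
- by move=> D mD x0; apply: null => //; left.
- by move=> D mD x0; apply: null => //; right.
- exact: i4.
- move=> D mD; rewrite pvm_measure_polar// spectral_measure_mul//.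
  rewrite Rintegral_mulr_indic RintegralZl//.
  exact: integrableS (spectral_id_integrable x).
have sE : (fun s : R => s ^+ n * (4 * s)) = (fun s : R => 4 * s ^+ n.+1).
  by apply/funext => s; rewrite exprSr; ring.
rewrite sE in isn sn.
have iS : (Em x).-integrable setT (EFin \o (fun s : R => s ^+ n.+1)).
  rewrite (_ : _ \o _ = (fun s : R =>
      (4^-1)%:E * (EFin \o (fun s => 4 * s ^+ n.+1)%R) s)%E).
    exact: integrableZl.
  by apply/funext => s /=; rewrite -EFinM mulrA mulVf ?mul1r.
split; first exact: iS.
move: sn; rewrite RintegralZl// => sn.
have linAn : linear (iter n A) by exact: linear_iter.
have symAn : adjoint (iter n A) (iter n A).
  by apply: adjoint_iter; exact: spectral_adjoint.
have e1 : inner (iter n A x) (A x) = inner (iter n.+1 A x) x.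
  by rewrite -spectral_adjoint.
have e2 : inner (iter n A (A x)) x = inner (iter n.+1 A x) x.
  by rewrite -iterSr.
apply: (@mulfI _ (4 : R[i])); first by rewrite pnatr_eq0.
have -> : 4 * (\int[Em x]_s (s ^+ n.+1))%:C = (4 * \int[Em x]_s (s ^+ n.+1))%:C.
  by rewrite rmorphM /= rmorph_nat.
rewrite -sn rmorphB /= -fp -fm linearMD// linearMB//.
rewrite !innerDl !innerDr !innerNl !innerNr e1 e2.
move: (inner _ _) (inner _ _) (inner _ _) => p q r; ring.
Qed.

Lemma spectral_iter_bound : exists2 B : R, 0 <= B &
  forall n x, l2norm (iter n A x) <= B ^+ n * l2norm x.
Proof.
have [[_ [M AM]] _] := AE; exists `|M|; first exact: normr_ge0.
elim=> [|n IH] x; first by rewrite expr0 mul1r.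
rewrite iterS exprS -mulrA; apply: le_trans (AM _) _.
apply: (@le_trans _ _ (`|M| * l2norm (iter n A x))).
  by apply: ler_wpM2r; [exact: sqrtr_ge0|exact: ler_norm].
by apply: ler_wpM2l.
Qed.

Lemma spectral_even_moment n x :
  \int[Em x]_s (s ^+ n.*2) = l2norm (iter n A x) ^+ 2.
Proof.
have [_] := spectral_moment n.*2 x; rewrite -addnn iterD.
have -> : inner (iter n A (iter n A x)) x = inner (iter n A x) (iter n A x).
  by rewrite adjoint_iter//; exact: spectral_adjoint.
by rewrite l2norm_sqr => ->.
Qed.

(** The moments of even order grow at most like the powers of the norm of A, so
    by Markov's inequality there is no mass beyond that norm. *)
Lemma spectral_bounded_support :
  exists2 r : R, 0 < r & forall x, Em x [set s | r <= `|s|] = 0%E.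
Proof.
have [B B0 AB] := spectral_iter_bound.
have r0 : 0 < B + 1 by rewrite ltr_wpDl.
exists (B + 1) => // x; set r := B + 1 in r0 *.
pose S : set (measurableTypeR R) := [set s | r <= `|s|].
have mS : measurable S by exact: measurable_norm_ge.
have le n : fine (Em x S) <= (B / r) ^+ n.*2 * l2norm x ^+ 2.
  have rn0 : 0 < r ^+ n.*2 by exact: exprn_gt0.
  have [i2 _] := spectral_moment n.*2 x.
  rewrite expr_div_n mulrAC ler_pdivlMr// mulrC.
  apply: (@le_trans _ _ (\int[Em x]_s (s ^+ n.*2))); last first.
    rewrite spectral_even_moment -muln2 exprM -exprMn ler_pXn2r ?nnegrE ?AB//.
      exact: sqrtr_ge0.
    by rewrite mulr_ge0 ?exprn_ge0 ?sqrtr_ge0.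
  rewrite -Rintegral_cst// -(Rintegral_mulr_indic _ _ (cst (r ^+ n.*2))).
  apply: le_Rintegral => //.
    apply: (@integrable_mulr_indic _ _ _ (Em x) S (cst (r ^+ n.*2))) => //.
    exact: finite_measure_integrable_cst.
  move=> s _; rewrite indicE; case: (boolP (s \in S)) => [|_]; last first.
    by rewrite /= mulr0 -muln2 mulnC exprM exprn_ge0 ?sqr_ge0.
  rewrite inE /S /= mulr1 => rs.
  have -> : s ^+ n.*2 = `|s| ^+ n.*2.
    by rewrite -normrX ger0_norm// -muln2 mulnC exprM exprn_ge0 ?sqr_ge0.
  by apply: lerXn2r rs; rewrite nnegrE ?normr_ge0 ?ltW.
have fin : (Em x S) \is a fin_num by exact: fin_num_measure.
rewrite -/S -(fineK fin); congr EFin; apply/eqP; rewrite eq_le.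
rewrite fine_ge0 ?measure_ge0// andbT.
have Br : `|B / r| < 1.
  rewrite ger0_norm; last by apply: divr_ge0 => //; exact: ltW.
  by rewrite ltr_pdivrMr// mul1r ltrDl.
have cv : (B / r) ^+ n.*2 * l2norm x ^+ 2 @[n --> \oo] --> 0 * l2norm x ^+ 2.
  apply: cvgMl.
  rewrite (_ : (fun n => _) = (fun n => ((B / r) ^+ 2) ^+ n)); last first.
    by apply/funext => n; rewrite -exprM -muln2 mulnC.
  by apply: cvg_expr; rewrite normrX expr_lt1.
rewrite mul0r in cv.
rewrite -(cvg_lim (@Rhausdorff R) cv); apply: limr_ge; first exact: cvgP cv.
exact: nearW.
Qed.

(** On the range of E ]-oo, 0[ the form of A is the integral of a negative
    function, so a positive A leaves no mass there. *)
Lemma spectral_positive_support : positive_operator A ->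
  forall x, Em x [set s | s < 0] = 0%E.
Proof.
move=> Apos x.
pose S : set (measurableTypeR R) := [set s | s < 0].
have mS : measurable S by exact: measurable_lt0.
have iid := spectral_id_integrable x.
have iS : (Em x).-integrable S (EFin \o (id : R -> R)) by exact: integrableS iid.
have mid : measurable_fun S (EFin \o (id : R -> R)) by exact: measurable_int iS.
have abs0 : (\int[Em x]_(s in S) `|(EFin \o (id : R -> R)) s| = 0)%E.
  have -> : (\int[Em x]_(s in S) `|(EFin \o (id : R -> R)) s| =
      \int[Em x]_(s in S) ((-1)%:E * (EFin \o (id : R -> R)) s))%E.
    apply: eq_integral => s; rewrite inE /S /= => s0.
    by rewrite ltr0_norm// -EFinM mulN1r.
  rewrite integralZl// -(fineK (integrable_fin_num mS iS)) -EFinM mulN1r.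
  congr EFin.
  apply/eqP; rewrite oppr_eq0 eq_le; apply/andP; split.
    rewrite -[leRHS](mul0r (fine (Em x S))) -Rintegral_cst//.
    apply: le_Rintegral => //; first exact: finite_measure_integrable_cst.
    by move=> s /ltW.
  have := Apos (E S x); rewrite lecE => /andP[_] /=.
  rewrite spectral_form_restr//.
  suff -> : \int[Em x]_s (s * \1_S s) = \int[Em x]_(s in S) s by [].
  exact: (Rintegral_mulr_indic (Em x) S (fun s : R => s)).
have /(ae_eq_integral_abs (Em x) mS mid)[N [mN N0 SN]] := abs0.
apply: subset_measure0 N0 => // s /= s0; apply: SN => /= /(_ s0) [s00].
by move: s0; rewrite /S /= s00 ltxx.
Qed.

Lemma spectral_integral_monomial n :
  is_pvm_integral E (fun s => (s ^+ n)%:C) (iter n A).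
Proof.
split; last first.
  move=> x; have [i1 f1] := spectral_moment n x; split.
    by split => //=; exact: (@finite_measure_integrable_cst _ _ _ _ setT 0).
  rewrite f1 /Cintegral; congr (_ +i* _).
  by rewrite /Rintegral integral0.
split; first exact: linear_iter.
by have [B _ AB] := spectral_iter_bound; exists (B ^+ n).
Qed.

End SpectralMoments.

(** * Polynomial approximation of indicator functions *)

Section PolynomialStep.
Variable R : realType.
Implicit Types x y t : R.

Lemma bernoulli_ineq (n : nat) y : -1 <= y -> 1 + n%:R * y <= (1 + y) ^+ n.
Proof.
move=> y1; elim: n => [|n IH]; first by rewrite mul0r addr0 expr0.
have y0 : 0 <= 1 + y by lra.
rewrite exprS; apply: le_trans (ler_wpM2l y0 IH).
have := mulr_ge0 (ler0n R n) (sqr_ge0 y); rewrite -natr1; nra.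
Qed.

Lemma cvg_natM_expr x : 0 <= x < 1 -> n%:R * x ^+ n @[n --> \oo] --> (0 : R).
Proof.
move=> /andP[x0 x1]; pose u := Num.sqrt x.
have u0 : 0 <= u by exact: sqrtr_ge0.
have xE : x = u ^+ 2 by rewrite sqr_sqrtr.
have u1 : u < 1 by rewrite -(ltr_pXn2r (n := 2)) ?nnegrE// -xE expr1n.
(* As u ^+ n <= u ^+ i for i < n, n u ^+ n is below a partial sum of the
   geometric series of ratio u. *)
have bound n : n%:R * u ^+ n <= (1 - u)^-1.
  rewrite -[leRHS]mul1r ler_pdivlMr ?subr_gt0// mulrC.
  apply: (@le_trans _ _ ((1 - u) * \sum_(i < n) u ^+ i)).
    rewrite ler_pM2l ?subr_gt0// mulr_natl -[n in _ *+ n]card_ord -sumr_const.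
    apply: ler_sum => i _.
    by apply: ler_wiXn2l; rewrite ?u0 ?ltW//= ltnW.
  have := subrX1 u n; have := exprn_ge0 n u0.
  by move: (\sum_(i < n) _) => S; lra.
apply: (@squeeze_cvgr _ _ _ _ (cst 0) (fun n => (1 - u)^-1 * u ^+ n)).
- apply: nearW => n /=; rewrite mulr_ge0 ?exprn_ge0//=.
  rewrite xE -exprM mulnC exprM expr2 mulrA; apply: ler_wpM2r => //.
  exact: exprn_ge0.
- exact: cvg_cst.
- rewrite -(mulr0 (1 - u)^-1); apply: cvgMr; apply: cvg_expr.
  by rewrite ger0_norm.
Qed.

(** The least natural number above n / t ^+ n, the rate that separates the powers
    x ^+ n with x < t from those with x >= t. *)
Definition step_exponent t (n : nat) : nat := (Num.truncn (n%:R * t^-1 ^+ n)).+1.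

Definition step_poly t (n : nat) : {poly R} := (1 - 'X^n) ^+ step_exponent t n.

Lemma horner_step_poly t (n : nat) x :
  (step_poly t n).[x] = (1 - x ^+ n) ^+ step_exponent t n.
Proof. by rewrite /step_poly !hornerE. Qed.

Lemma step_poly_itv t (n : nat) x : 0 <= x <= 1 -> 0 <= (step_poly t n).[x] <= 1.
Proof.
move=> /andP[x0 x1]; rewrite horner_step_poly.
have xn0 : 0 <= x ^+ n by exact: exprn_ge0.
have xn1 : x ^+ n <= 1 by exact: exprn_ile1.
by rewrite exprn_ge0 ?subr_ge0//= exprn_ile1// ?subr_ge0// gerBl.
Qed.

(** With k of order n / t ^+ n, the product k x ^+ n tends to 0 below t and is at
    least n from t on; the first makes (1 - x ^+ n) ^+ k >= 1 - k x ^+ n tend to 1,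
    the second makes (1 - x ^+ n) ^+ k <= 1 / (1 + k x ^+ n) tend to 0. *)
Lemma cvg_step_poly t x : 0 < t -> 0 <= x < 1 ->
  (step_poly t n).[x] @[n --> \oo] --> ((x < t)%R%:R : R).
Proof.
move=> t0 /andP[x0 x1].
have x01 : 0 <= x <= 1 by rewrite x0 ltW.
have xn n : 0 <= x ^+ n <= 1.
  by apply/andP; split; [exact: exprn_ge0|apply: exprn_ile1 => //; exact: ltW].
have tn n : 0 <= n%:R * t^-1 ^+ n.
  by rewrite mulr_ge0// exprn_ge0// invr_ge0 ltW.
have [xt|tx] := ltP x t.
- have pow n : n%:R * t^-1 ^+ n * x ^+ n = n%:R * (x / t) ^+ n.
    by rewrite -mulrA -exprMn [t^-1 * x]mulrC.
  apply: (@squeeze_cvgr _ _ _ _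
    (fun n => 1 - (n%:R * (x / t) ^+ n + x ^+ n)) (cst 1)).
  + apply: nearW => n /=; apply/andP; split; last first.
      by have /andP[] := step_poly_itv t n x01.
    rewrite horner_step_poly; have /andP[xn0 xn1] := xn n.
    have yge : -1 <= - x ^+ n by rewrite lerN2.
    apply: le_trans (bernoulli_ineq _ yge).
    rewrite mulrN lerD2l lerN2 -pow -[X in _ + X]mul1r -mulrDl.
    apply: ler_wpM2r => //; rewrite /step_exponent -natr1 lerD2r.
    by have /andP[] := truncn_itv (tn n).
  + rewrite -[X in _ --> X]subr0 -[X in _ --> _ - X](addr0 0).
    apply: cvgB; first exact: cvg_cst.
    apply: cvgD; last by apply: cvg_expr; rewrite ger0_norm.
    apply: cvg_natM_expr; rewrite divr_ge0//; last exact: ltW.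
    by rewrite /= ltr_pdivrMr// mul1r.
  + exact: cvg_cst.
- apply: (@squeeze_cvgr _ _ _ _ (cst 0) harmonic).
  + apply: nearW => n /=; apply/andP; split.
      by have /andP[] := step_poly_itv t n x01.
    rewrite horner_step_poly; have /andP[xn0 xn1] := xn n.
    set k := step_exponent t n.
    have kn : n%:R <= k%:R * x ^+ n.
      apply: (@le_trans _ _ (n%:R * t^-1 ^+ n * x ^+ n)); last first.
        apply: ler_wpM2r => //; apply: ltW.
        by have /andP[] := truncn_itv (tn n).
      rewrite -mulrA -exprMn ler_peMr//; apply: exprn_ege1.
      by rewrite mulrC ler_pdivlMr// mul1r.
    have yge : -1 <= x ^+ n by apply: le_trans xn0; rewrite lerN10.
    have h1 := bernoulli_ineq k yge.
    have y0 : 0 <= (1 - x ^+ n) ^+ k by rewrite exprn_ge0// subr_ge0.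
    rewrite -[leRHS]mul1r ler_pdivlMr//.
    apply: (@le_trans _ _ ((1 - x ^+ n) ^+ k * (1 + x ^+ n) ^+ k)).
      apply: ler_wpM2l => //; apply: le_trans h1.
      by rewrite -natr1 addrC lerD2l.
    rewrite -exprMn -subr_sqr expr1n exprn_ile1 ?subr_ge0 ?gerBl ?sqr_ge0//.
    by rewrite exprn_ile1.
  + exact: cvg_cst.
  + exact: cvg_harmonic.
Qed.

End PolynomialStep.

(** * Measures determined by their even moments *)

Section EvenMoments.
Variable R : realType.
Notation MR := (measurableTypeR R).
Local Notation absR := (fun s : R => `|s|%R).
Implicit Types (m : {finite_measure set MR -> \bar R}) (g : R -> R) (r t : R).

Lemma measurable_norm_preimage (D : set MR) : measurable D ->
  measurable (absR @^-1` D : set MR).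
Proof.
by move=> mD; rewrite -[X in measurable X]setTI; exact: normr_measurable.
Qed.

Lemma ae_le_integrable m (f g : R -> R) : measurable_fun setT (f : MR -> R) ->
  {ae m, forall s : MR, `|f s| <= `|g s|} -> m.-integrable setT (EFin \o g) ->
  m.-integrable setT (EFin \o f).
Proof.
move=> mf [S [mS S0 fgS]] ig.
have fS s : s \notin S -> `|f s| <= `|g s|.
  by rewrite notin_setE; apply: contra_notP; exact: fgS.
apply: (@ae_eq_integrable _ _ _ m setT (EFin \o (fun s => f s * \1_(~` S) s))) => //.
- apply: le_integrable ig => //.
    apply/measurable_EFinP; apply: measurable_funM => //.
    by apply: measurable_indic; exact: measurableC.
  move=> s _ /=; rewrite lee_fin normrM indicE in_setC.
  have [sS|sS] := boolP (s \in S); first by rewrite /= normr0 mulr0.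
  by rewrite /= normr1 mulr1; exact: fS.
- exact/measurable_EFinP.
- exists S; split => // s /=; apply: contra_notP => sS _.
  by congr EFin; rewrite indicE mem_set ?mulr1.
Qed.

Lemma ae_bounded_support m r (P : R -> Prop) : m [set s | r <= `|s|] = 0%E ->
  (forall s, `|s| < r -> P s) -> {ae m, forall s : MR, P s}.
Proof.
move=> mr rP; exists [set s | r <= `|s|]; split => //.
  exact: measurable_norm_ge.
by move=> s /=; apply: contra_notP => /negP; rewrite -ltNge => /rP.
Qed.

Lemma integrable_even_monomial m r g k :
  m [set s | r <= `|s|] = 0%E -> m.-integrable setT (EFin \o g) ->
  m.-integrable setT (EFin \o (fun s => s ^+ k.*2 * g s)).
Proof.
move=> mr ig.
have mg : measurable_fun setT (g : MR -> R).
  by apply/measurable_EFinP; exact: measurable_int ig.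
apply: (ae_le_integrable (g := fun s => r ^+ k.*2 * g s)) => //.
- by apply: measurable_funM => //; exact: exprn_measurable.
- apply: (ae_bounded_support mr) => s sr; rewrite !normrM; apply: ler_wpM2r => //.
  rewrite !normrX; apply: lerXn2r; rewrite ?nnegrE ?normr_ge0//.
  by rewrite (le_trans (ltW sr))// ler_norm.
- rewrite (_ : _ \o _ = (fun s => (r ^+ k.*2)%:E * (EFin \o g) s)%E)//.
  exact: integrableZl.
Qed.

Lemma horner_sqr_step (p : {poly R}) (c s x : R) k :
  s ^+ k.*2 * ((p * 'X + c%:P).[s ^+ 2] * x) =
  s ^+ k.+1.*2 * (p.[s ^+ 2] * x) + c * (s ^+ k.*2 * x).
Proof.
have -> : k.+1.*2 = (k.*2 + 2)%N by rewrite doubleS addn2.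
rewrite hornerMXaddC (exprD s k.*2 2).
by move: (s ^+ k.*2) (s ^+ 2) => u w; ring.
Qed.

Lemma integrable_even_poly m r g (p : {poly R}) k :
  m [set s | r <= `|s|] = 0%E -> m.-integrable setT (EFin \o g) ->
  m.-integrable setT (EFin \o (fun s => s ^+ k.*2 * (p.[s ^+ 2] * g s))).
Proof.
move=> mr ig; elim/poly_ind: p k => [|p c IH] k.
  rewrite (_ : (fun s => _) = cst 0); last first.
    by apply/funext => s; rewrite horner0 mul0r mulr0.
  exact: finite_measure_integrable_cst.
rewrite (_ : _ \o _ =
    (EFin \o (fun s => s ^+ k.+1.*2 * (p.[s ^+ 2] * g s))%R) \+
    (fun s => c%:E * (EFin \o (fun s => s ^+ k.*2 * g s)%R) s))%E; last first.
  by apply/funext => s /=; rewrite horner_sqr_step.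
apply: integrableD => //; apply: integrableZl => //.
exact: integrable_even_monomial k mr ig.
Qed.

Lemma even_poly_moment_eq m1 m2 r g1 g2 :
  m1 [set s | r <= `|s|] = 0%E -> m1.-integrable setT (EFin \o g1) ->
  m2 [set s | r <= `|s|] = 0%E -> m2.-integrable setT (EFin \o g2) ->
  (forall k, \int[m1]_s (s ^+ k.*2 * g1 s) = \int[m2]_s (s ^+ k.*2 * g2 s)) ->
  forall (p : {poly R}) k, \int[m1]_s (s ^+ k.*2 * (p.[s ^+ 2] * g1 s)) =
    \int[m2]_s (s ^+ k.*2 * (p.[s ^+ 2] * g2 s)).
Proof.
move=> mr1 ig1 mr2 ig2 mom; elim/poly_ind => [|p c IH] k.
  under eq_Rintegral do rewrite horner0 mul0r mulr0.
  under [RHS]eq_Rintegral do rewrite horner0 mul0r mulr0.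
  by rewrite !Rintegral_cst// !mul0r.
have split m g : m [set s | r <= `|s|] = 0%E ->
    m.-integrable setT (EFin \o g) ->
    \int[m]_s (s ^+ k.*2 * ((p * 'X + c%:P).[s ^+ 2] * g s)) =
    \int[m]_s (s ^+ k.+1.*2 * (p.[s ^+ 2] * g s)) +
    c * \int[m]_s (s ^+ k.*2 * g s).
  move=> mr ig; under eq_Rintegral do rewrite horner_sqr_step.
  have im : m.-integrable setT (EFin \o (fun s => s ^+ k.*2 * g s)).
    exact: integrable_even_monomial k mr ig.
  rewrite RintegralD//; first by rewrite RintegralZl.
  - exact: integrable_even_poly p k.+1 mr ig.
  - rewrite (_ : _ \o _ =
      (fun s => c%:E * (EFin \o (fun s => s ^+ k.*2 * g s)%R) s))%E//.
    exact: integrableZl.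
by rewrite !split// IH mom.
Qed.

Lemma cvg_step_integral m r g t : 0 < r -> 0 < t ->
  m [set s | r <= `|s|] = 0%E -> m.-integrable setT (EFin \o g) ->
  \int[m]_s (((step_poly ((t / r) ^+ 2) n).[(s / r) ^+ 2]) * g s)
    @[n --> \oo] --> \int[m]_(s in [set s | `|s| < t]) g s.
Proof.
move=> r0 t0 mr ig; set th := (t / r) ^+ 2.
have th0 : 0 < th by rewrite exprn_gt0 ?divr_gt0.
have sq01 s : `|s| < r -> 0 <= (s / r) ^+ 2 < 1.
  move=> sr; rewrite sqr_ge0/= -(real_normK (num_real _)) expr_lt1//.
  by rewrite normrM normfV (gtr0_norm r0) ltr_pdivrMr// mul1r.
have mg : measurable_fun setT (g : MR -> R).
  by apply/measurable_EFinP; exact: measurable_int ig.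
have ms n : measurable_fun setT (fun s : MR => (step_poly th n).[(s / r) ^+ 2]).
  under eq_fun do rewrite horner_step_poly.
  apply: measurable_funX; apply: measurable_funB => //.
  by apply: measurable_funX; apply: measurable_funX; exact: measurable_funM.
pose S : set MR := [set s | `|s| < t].
have mS : measurable S.
  rewrite (_ : S = ~` [set s | t <= `|s|]).
    by apply: measurableC; exact: measurable_norm_ge.
  by apply/seteqP; split => s; rewrite /S /= ltNge => /negP.
have ind s : `|s| < r -> ((s / r) ^+ 2 < th)%R%:R = \1_S s :> R.
  move=> sr; rewrite indicE; congr (nat_of_bool _)%:R.
  rewrite -[(s / r) ^+ 2](real_normK (num_real _)).
  rewrite ltr_pXn2r ?nnegrE ?normr_ge0 ?divr_ge0 ?(ltW t0) ?(ltW r0)//.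
  rewrite normrM normfV (gtr0_norm r0) ltr_pM2r ?invr_gt0//.
  by apply/idP/idP; rewrite inE.
have [|||||_ _ cv] := @dominated_convergence _ _ _ m setT measurableT
  (fun n s => ((step_poly th n).[(s / r) ^+ 2] * g s)%:E)
  (fun s => (g s * \1_S s)%:E) (fun s => `|g s|%:E).
- by move=> n; apply/measurable_EFinP; exact: measurable_funM.
- apply/measurable_EFinP; apply: measurable_funM; first exact: mg.
  by apply: measurable_indic.
- apply: (ae_bounded_support mr) => s sr _; apply: cvg_EFin; first exact: nearW.
  rewrite [X in _ --> X]mulrC -(ind _ sr); apply: cvgMl.
  by apply: cvg_step_poly => //; exact: sq01.
- exact: (integrable_abse ig).
- apply: (ae_bounded_support mr) => s sr n _ /=; rewrite lee_fin normrM ler_piMl//.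
  have /andP[sr0 sr1] := sq01 _ sr.
  have /andP[p0 p1] : 0 <= (step_poly th n).[(s / r) ^+ 2] <= 1.
    by apply: step_poly_itv; rewrite sr0 ltW.
  by rewrite ger0_norm.
have iS : m.-integrable setT (EFin \o (fun s => g s * \1_S s)).
  exact: integrable_mulr_indic.
rewrite -Rintegral_mulr_indic; apply: fine_cvg; rewrite fineK//.
exact: integrable_fin_num iS.
Qed.

(** The signed measures g1 m1 and g2 m2 have the same image under the absolute
    value: polynomials in s ^+ 2 approximate the indicator functions of the sets
    |s| < t, and the images of these sets generate the Borel sets. *)
Lemma even_moments_determine m1 m2 r g1 g2 : 0 < r ->
  m1 [set s | r <= `|s|] = 0%E -> m1.-integrable setT (EFin \o g1) ->
  m2 [set s | r <= `|s|] = 0%E -> m2.-integrable setT (EFin \o g2) ->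
  (forall k, \int[m1]_s (s ^+ k.*2 * g1 s) = \int[m2]_s (s ^+ k.*2 * g2 s)) ->
  forall D : set MR, measurable D ->
    \int[m1]_(s in absR @^-1` D) g1 s =
    \int[m2]_(s in absR @^-1` D) g2 s.
Proof.
move=> r0 mr1 ig1 mr2 ig2 mom D mD.
have total : \int[m1]_s g1 s = \int[m2]_s g2 s.
  have := mom 0%N; rewrite double0.
  by under eq_Rintegral do rewrite expr0 mul1r;
    under [RHS]eq_Rintegral do rewrite expr0 mul1r.
pose G : set (set MR) := [set A | exists t : R, A = `]-oo, t[%classic].
have mG : measurable = <<s G >> by exact: RGenInftyO.measurableE.
apply: (@dynkin_induction _ MR G (fun D => \int[m1]_(s in absR @^-1` D) g1 s =
    \int[m2]_(s in absR @^-1` D) g2 s)) => //.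
- move=> A B [t ->] [u ->]; exists (Num.min t u).
  by apply/seteqP; split => s /=; rewrite !in_itv/= lt_min => /andP.
- move=> A [t ->].
  have -> : absR @^-1` `]-oo, t[ = [set s | `|s| < t].
    by apply/seteqP; split => s /=; rewrite in_itv.
  have [t0|t0] := leP t 0.
    rewrite (_ : [set s | _] = set0) ?Rintegral_set0//.
    apply/seteqP; split => // s /= st.
    by have := lt_le_trans st t0; rewrite normr_lt0.
  have cv1 := cvg_step_integral r0 t0 mr1 ig1.
  have cv2 := cvg_step_integral r0 t0 mr2 ig2.
  apply: (cvg_unique _ cv1); first exact: Rhausdorff.
  rewrite (_ : (fun n => _) = (fun n =>
    \int[m2]_s ((step_poly ((t / r) ^+ 2) n).[(s / r) ^+ 2] * g2 s)))//.
  apply/funext => n.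
  pose p := step_poly ((t / r) ^+ 2) n \Po ((r^-1 ^+ 2) *: 'X).
  have pE s : (step_poly ((t / r) ^+ 2) n).[(s / r) ^+ 2] = p.[s ^+ 2].
    by rewrite horner_comp hornerZ hornerX -exprMn [r^-1 * s]mulrC.
  have := even_poly_moment_eq mr1 ig1 mr2 ig2 mom p 0.
  rewrite double0; under eq_Rintegral do rewrite expr0 mul1r -pE.
  by under [RHS]eq_Rintegral do rewrite expr0 mul1r -pE.
- move=> S mS eqS.
  have compl m g : m.-integrable setT (EFin \o g) ->
      \int[m]_(s in absR @^-1` (~` S)) g s =
      \int[m]_s g s - \int[m]_(s in absR @^-1` S) g s.
    move=> ig; have mN := measurable_norm_preimage mS.
    rewrite preimage_setC -[in \int[m]_s g s](setUv (absR @^-1` S)).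
    rewrite Rintegral_setU//; first by rewrite addrAC subrr add0r.
    + exact: measurableC.
    + by rewrite setUv.
    + by apply/disj_setPCl.
  by rewrite !compl// total eqS.
- move=> F mF tF eqF.
  have tN : trivIset setT (fun k => absR @^-1` (F k)).
    apply/trivIsetP => i j _ _ ij; rewrite -preimage_setI.
    by move/trivIsetP : tF => /(_ i j I I ij) ->; rewrite preimage_set0.
  have mN k : measurable (absR @^-1` (F k) : set MR).
    exact: measurable_norm_preimage.
  have iF m g k : m.-integrable setT (EFin \o g) ->
      m.-integrable (absR @^-1` (F k)) (EFin \o g).
    by move=> ig; apply: integrableS ig.
  have union m g : m.-integrable setT (EFin \o g) ->
      (\int[m]_(s in absR @^-1` (\bigcup_k F k)) (g s)%:E =
      \sum_(k <oo) (\int[m]_(s in absR @^-1` (F k)) g s)%:E)%E.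
    move=> ig; rewrite preimage_bigcup integral_bigcup//.
      apply: eq_eseriesr => k _; rewrite fineK//.
      by apply: integrable_fin_num => //; exact: iF.
    by apply: integrableS ig => //; exact: bigcup_measurable.
  rewrite {1}/Rintegral union// [in RHS]/Rintegral union//.
  by congr fine; apply: eq_eseriesr => k _; rewrite eqF.
- by rewrite -mG.
Qed.

(** * Densities from even and odd moments *)

Lemma opp_imageE (D : set MR) :
  [set - (x : R) | x in D] = (fun s : R => - s) @^-1` D.
Proof.
apply/seteqP; split => s /=; first by move=> [x Dx <-]; rewrite opprK.
by move=> Ds; exists (- s) => //; rewrite opprK.
Qed.

Lemma measurable_opp_image (D : set MR) : measurable D ->
  measurable ([set - (x : R) | x in D] : set MR).
Proof.
move=> mD; rewrite opp_imageE -[X in measurable X]setTI.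
exact: oppr_measurable.
Qed.

Section HalfLine.
Variables (M N : {finite_measure set MR -> \bar R}) (r : R).
Hypotheses (r0 : 0 < r) (Mr : M [set s | r <= `|s|] = 0%E)
  (Nr : N [set s | r <= `|s|] = 0%E) (Nneg : N [set s | s < 0] = 0%E).

Local Notation I := (`[0, +oo[%classic : set MR).

Let mI : measurable I. Proof. exact: measurable_itv. Qed.

Lemma id_integrable m : m [set s | r <= `|s|] = 0%E ->
  m.-integrable setT (EFin \o (id : R -> R)).
Proof.
move=> mr; apply: (ae_le_integrable (g := cst r)) => //.
  by apply: (ae_bounded_support mr) => s sr /=; rewrite (gtr0_norm r0) ltW.
exact: finite_measure_integrable_cst.
Qed.

Lemma ae_nonneg (P : R -> Prop) :
  {ae N, forall s : MR, 0 <= (s : R) -> P s} -> {ae N, forall s : MR, P s}.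
Proof.
move=> [S [mS S0 PS]].
have mneg : measurable ([set s | s < 0] : set MR) by exact: measurable_lt0.
exists (S `|` [set s | s < 0]); split; first exact: measurableU.
  exact: null_set_setU.
move=> s /= nPs; have [s0|s0] := ltP s 0; first by right.
by left; apply: PS => /= /(_ s0).
Qed.

(** Extend g2 by 0 to the negative half-line: the extension has the even moments
    of g2 on I, and the preimage of D by the absolute value meets I in D. *)
Lemma half_line_moments_determine (g1 g2 : R -> R) :
  M.-integrable setT (EFin \o g1) -> N.-integrable setT (EFin \o g2) ->
  (forall k, \int[M]_s (s ^+ k.*2 * g1 s) =
     \int[N]_(s in I) (s ^+ k.*2 * g2 s)) ->
  forall D : set MR, measurable D -> D `<=` I ->
    \int[M]_(s in absR @^-1` D) g1 s = \int[N]_(s in D) g2 s.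
Proof.
move=> ig1 ig2 mom D mD DI.
have ig2I : N.-integrable setT (EFin \o (g2 \_ I)).
  rewrite -restrict_EFin; apply/(integrable_mkcond _ mI).1.
  exact: integrableS ig2.
rewrite (even_moments_determine r0 Mr ig1 Nr ig2I _ mD).
  rewrite Rintegral_mkcond [RHS]Rintegral_mkcond; apply: eq_Rintegral => s _.
  rewrite !patchE; have [s0|s0] := leP 0 s.
    have sI : s \in I by rewrite inE /= in_itv/= s0.
    have sA : (s \in absR @^-1` D) = (s \in D).
      by apply/idP/idP; rewrite !inE /= (ger0_norm s0).
    by rewrite sI sA.
  have sI : (s \in I) = false.
    by apply/negbTE; rewrite notin_setE /= in_itv/= andbT leNgt s0.
  have sD : (s \in D) = false.
    by apply/negbTE; rewrite notin_setE => /DI; rewrite /= in_itv/= andbT leNgt s0.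
  by rewrite sI sD; case: ifP.
move=> k; rewrite mom Rintegral_mkcond; apply: eq_Rintegral => s _.
by rewrite !patchE; case: ifP => _; rewrite ?mulr0.
Qed.

Lemma abs_preimage_null (D : set MR) : measurable D -> N (absR @^-1` D) = N D.
Proof.
move=> mD; have mA := measurable_norm_preimage mD.
have mneg : measurable ([set s | s < 0] : set MR) by exact: measurable_lt0.
have split (B : set MR) : measurable B -> N B = N (B `&` I).
  move=> mB; rewrite -[in LHS](setIT B) -(setUv I) setIUr measureU//.
  - rewrite [X in _ + X](_ : _ = 0%E) ?addr0//.
    apply: subset_measure0 Nneg => //.
      by apply: measurableI => //; exact: measurableC.
    by move=> s [_ /=]; rewrite in_itv/= andbT => /negP; rewrite -ltNge.
  - exact: measurableI.
  - by apply: measurableI => //; exact: measurableC.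
  - by rewrite setIACA setICr setI0.
rewrite split// [RHS]split//; congr (N _); apply/seteqP; split => s [] /=;
  rewrite in_itv/= andbT => + s0; by rewrite (ger0_norm s0).
Qed.

Hypothesis even_moments :
  forall k, \int[M]_s (s ^+ k.*2) = \int[N]_s (s ^+ k.*2).

Lemma abs_image_measure (D : set MR) : measurable D -> M (absR @^-1` D) = N D.
Proof.
move=> mD; rewrite -abs_preimage_null//.
have mA := measurable_norm_preimage mD.
have i1 m : m.-integrable setT (EFin \o (cst 1 : R -> R)).
  exact: finite_measure_integrable_cst.
have := even_moments_determine r0 Mr (i1 M) Nr (i1 N) _ mD.
rewrite !Rintegral_cst// !mul1r => MN.
rewrite -[LHS]fineK ?fin_num_measure// -[RHS]fineK ?fin_num_measure//.
congr EFin; apply: MN => k.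
by under eq_Rintegral do rewrite mulr1; under [RHS]eq_Rintegral do rewrite mulr1.
Qed.

(** As N is carried by the half-line, the image of M by the absolute value is N
    itself, and the integral is that of the image measure. *)
Lemma abs_image_integral (D : set MR) : measurable D -> D `<=` I ->
  \int[M]_(s in absR @^-1` D) `|s| = \int[N]_(s in D) s.
Proof.
move=> mD DI; have mabs : measurable_fun setT (absR : MR -> MR).
  exact: normr_measurable.
rewrite /Rintegral; congr fine.
have iabs : M.-integrable (absR @^-1` D) (EFin \o absR).
  apply: (integrableS measurableT) => //; first exact: measurable_norm_preimage.
  exact: integrable_abse (id_integrable Mr).
have mE : measurable_fun setT (EFin : MR -> \bar R) by exact/measurable_EFinP.
have pf := integral_pushforward mabs mE iabs mD.
apply: etrans (esym pf) _.
by apply: eq_measure_integral => B mB _; exact: abs_image_measure.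
Qed.

Variable p : R -> R.
Hypotheses (mp : measurable_fun setT (p : MR -> R)) (p0 : p 0 = 1)
  (p1 : {ae N, forall s : MR, 0 <= (s : R) -> `|p s| <= 1}).
Hypothesis odd_moments : forall k, \int[M]_s (s ^+ k.*2.+1) =
  \int[N]_(s in I) (s ^+ k.*2.+1 * p s).

Lemma density_integrable : N.-integrable setT (EFin \o p).
Proof.
apply: (ae_le_integrable (g := cst 1)) => //.
  by apply: ae_nonneg; apply: filterS p1 => s p1s /p1s; rewrite /= normr1.
exact: finite_measure_integrable_cst.
Qed.

Lemma id_density_integrable : N.-integrable setT (EFin \o (fun s => s * p s)).
Proof.
apply: (ae_le_integrable (g := id)) => //; last exact: id_integrable.
  exact: measurable_funM.
apply: ae_nonneg; apply: filterS p1 => s p1s /p1s p1s'.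
by rewrite normrM ler_piMr.
Qed.

Lemma mean_integrable : N.-integrable setT (EFin \o (fun s => (1 + p s) / 2)).
Proof.
have -> : EFin \o (fun s => (1 + p s) / 2) =
    (fun s : R => (2^-1)%:E * ((EFin \o cst 1%R) \+ (EFin \o p)) s)%E.
  by apply/funext => s /=; rewrite -EFinD -EFinM mulrC.
apply: integrableZl => //; apply: integrableD => //.
  exact: finite_measure_integrable_cst.
exact: density_integrable.
Qed.

Lemma id_mean_integrable :
  N.-integrable setT (EFin \o (fun s => s * ((1 + p s) / 2))).
Proof.
have -> : EFin \o (fun s => s * ((1 + p s) / 2)) =
    (fun s : R => (2^-1)%:E * ((EFin \o (fun s => s * p s)%R) \+ (EFin \o id)) s)%E.
  apply/funext => s /=; rewrite -EFinD -EFinM; congr EFin.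
  by rewrite mulrA mulrC mulrDr mulr1 [s + _]addrC.
apply: integrableZl => //; apply: integrableD => //; last exact: id_integrable.
exact: id_density_integrable.
Qed.

(** On the positive half-line, 2 s dM = (s + |s|) dM, and the two terms have
    images s p dN and s dN under the absolute value. *)
Lemma id_density_half_line (D : set MR) : measurable D -> D `<=` I ->
  \int[M]_(s in D) s = \int[N]_(s in D) (s * ((1 + p s) / 2)).
Proof.
move=> mD DI; have mA := measurable_norm_preimage mD.
have idM := id_integrable Mr; have idN := id_integrable Nr.
have spN := id_density_integrable.
have odd : \int[M]_(s in absR @^-1` D) s = \int[N]_(s in D) (s * p s).
  apply: half_line_moments_determine => // k.
  under eq_Rintegral do rewrite -exprSr.
  by rewrite odd_moments; apply: eq_Rintegral => s _; rewrite mulrA -exprSr.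
have even := abs_image_integral mD DI.
have iA m (f : R -> R) (B : set MR) : measurable B ->
    m.-integrable setT (EFin \o f) -> m.-integrable B (EFin \o f).
  by move=> mB; exact: integrableS.
have iabs : M.-integrable setT (EFin \o absR) by exact: integrable_abse idM.
have twice : \int[M]_(s in absR @^-1` D) (s + `|s|) = \int[M]_(s in D) (2 * s).
  rewrite Rintegral_mkcond [RHS]Rintegral_mkcond; apply: eq_Rintegral => s _.
  rewrite !patchE; have [s0|s0] := leP 0 s.
    have sA : (s \in absR @^-1` D) = (s \in D).
      by apply/idP/idP; rewrite !inE /= (ger0_norm s0).
    by rewrite sA (ger0_norm s0) mulr_natl mulr2n.
  have sD : (s \in D) = false.
    by apply/negbTE; rewrite notin_setE => /DI; rewrite /= in_itv/= andbT leNgt s0.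
  by rewrite sD ltr0_norm// subrr; case: ifP.
rewrite RintegralD in twice; [|exact: mA|exact: iA|exact: iA].
rewrite odd even RintegralZl in twice; [|exact: mD|exact: iA].
rewrite -RintegralD in twice; [|exact: mD|exact: iA|exact: iA].
apply: (@mulfI _ (2 : R)); first by rewrite pnatr_eq0.
rewrite -twice -RintegralZl//; last first.
  exact: iA id_mean_integrable.
by apply: eq_Rintegral => s _; field.
Qed.

(** To divide the measure identity for s by s, pass to a density h of M on the
    half-line: then s h(s) = s (1 + p s) / 2 almost everywhere. *)
Lemma half_line_density_pos (D : set MR) : measurable D -> D `<=` `]0, +oo[ ->
  fine (M D) = \int[N]_(s in D) ((1 + p s) / 2).
Proof.
move=> mD D0.
have DI : D `<=` I by move=> s /D0 /=; rewrite !in_itv/= !andbT => /ltW.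
pose MI : {finite_measure set MR -> \bar R} := mrestr M mI.
have MI0 B : measurable B -> N B = 0%E -> MI B = 0%E.
  move=> mB NB0.
  have mBI : measurable (B `&` I) by exact: measurableI.
  have : N (B `&` I) = 0%E by apply: subset_measure0 NB0 => //; exact: subIsetl.
  rewrite -abs_image_measure// /MI/= /mrestr; apply: subset_measure0 => //.
    exact: measurable_norm_preimage.
  move=> s [Bs Is]; have := Is; rewrite /= in_itv/= andbT => s0.
  by rewrite /= (ger0_norm s0).
have MIE B : measurable B -> B `<=` I -> MI B = M B.
  by move=> mB BI; rewrite /MI /= /mrestr setIidl.
have [h [ih hE hf]] := density_exists MI0.
have idMI : MI.-integrable setT (EFin \o (id : R -> R)).
  apply: id_integrable; apply: subset_measure0 Mr.
  - by apply: measurableI => //; exact: measurable_norm_ge.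
  - exact: measurable_norm_ge.
  - exact: subIsetl.
have sh : ae_eq N D (EFin \o (fun s => s * h s))
    (EFin \o (fun s => s * ((1 + p s) / 2))).
  have [ish _] := hf id setT measurableT idMI.
  apply: integral_ae_eq => //.
  - exact: integrableS ish.
  - apply/measurable_EFinP; apply: measurable_funTS; apply: measurable_funM => //.
    by apply: measurable_funM => //; apply: measurable_funD.
  - move=> B BD mB; have BI := subset_trans BD DI.
    have idMIB : MI.-integrable B (EFin \o (id : R -> R)) by exact: integrableS idMI.
    have [ishB eqB] := hf id B mB idMIB.
    have eqM : \int[MI]_(s in B) s = \int[M]_(s in B) s.
      rewrite /Rintegral; congr fine; apply: eq_measure_integral => C mC CB.
      exact: MIE mC (subset_trans CB BI).
    have := id_density_half_line mB BI; rewrite -eqM eqB => eqhp.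
    rewrite -[LHS]fineK; last exact: (integrable_fin_num mB ishB).
    rewrite -[RHS]fineK; last first.
      by apply: integrable_fin_num => //; exact: integrableS id_mean_integrable.
    by congr EFin.
rewrite -(MIE _ mD DI) hE// /Rintegral; congr fine; apply: ae_eq_integral => //.
- by apply: measurable_funTS; exact: measurable_int ih.
- apply/measurable_EFinP; apply: measurable_funTS.
  by apply: measurable_funM => //; apply: measurable_funD.
- apply: filterS sh => s /= shs Ds; congr EFin.
  have := D0 _ Ds; rewrite /= in_itv/= andbT => s0.
  by have [] := shs Ds; apply: mulfI; rewrite gt_eqF.
Qed.

(** At 0 division by s gives nothing, but the singleton is its own preimage by the
    absolute value, so M and N agree on it, and (1 + p 0) / 2 = 1. *)
Lemma half_line_density_nonneg (D : set MR) : measurable D -> D `<=` I ->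
  fine (M D) = \int[N]_(s in D) ((1 + p s) / 2).
Proof.
move=> mD DI; pose Z : set MR := [set 0].
have mZ : measurable Z by exact: measurable_set1.
have mDZ : measurable (D `&` Z) by exact: measurableI.
have mDC : measurable (D `\` Z) by exact: measurableD.
have DE : D = (D `&` Z) `|` (D `\` Z).
  by rewrite setDE -setIUr setUv setIT.
have disj : (D `&` Z) `&` (D `\` Z) = set0.
  by rewrite setDE setIACA setICr setI0.
rewrite [in LHS]DE measureU// fineD ?fin_num_measure//.
rewrite (half_line_density_pos mDC); last first.
  move=> s [/DI + nZ]; rewrite /= !in_itv/= !andbT le_eqVlt => /orP[/eqP s0|//].
  by case: nZ; rewrite /Z /= s0.
rewrite [in RHS]DE Rintegral_setU//; last 2 first.
- by apply: integrableS mean_integrable => //; exact: measurableU.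
- by apply/disj_setPS; rewrite disj.
congr (_ + _).
transitivity (\int[N]_(s in D `&` Z) (1 : R)).
  rewrite Rintegral_cst// mul1r; congr fine.
  apply: etrans (abs_image_measure mDZ); congr (M _).
  apply/seteqP; split => s /= [Ds s0]; first by rewrite s0 normr0 -{1}s0.
  by move/normr0_eq0 : s0 Ds => ->; rewrite normr0.
apply: eq_Rintegral => s; rewrite inE => -[_ /= ->].
by rewrite p0; field.
Qed.

(** The preimage of D by the absolute value is D together with its reflection. *)
Lemma half_line_density_neg (D : set MR) : measurable D -> D `<=` `]0, +oo[ ->
  fine (M [set - (x : R) | x in D]) = \int[N]_(s in D) ((1 - p s) / 2).
Proof.
move=> mD D0.
have oppE := opp_imageE D; have mop := measurable_opp_image mD.
have absE : absR @^-1` D = D `|` [set - (x : R) | x in D].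
  apply/seteqP; split => s; rewrite oppE /=.
    by have [s0|s0] := leP 0 s; [rewrite ger0_norm//; left|rewrite ltr0_norm//; right].
  by case=> /[dup] Ds /D0; rewrite /= in_itv/= andbT => s0;
    [rewrite gtr0_norm|rewrite ltr0_norm// -oppr_gt0].
have ND : fine (N D) = fine (M D) + fine (M [set - (x : R) | x in D]).
  rewrite -abs_image_measure// absE measureU//.
    by rewrite fineD ?fin_num_measure.
  rewrite oppE; apply/seteqP; split => // s [Ds Dns].
  have := D0 _ Ds; have := D0 _ Dns; rewrite /= !in_itv/= !andbT oppr_gt0 => s1 s2.
  by have := lt_trans s1 s2; rewrite ltxx.
rewrite (half_line_density_pos mD D0) in ND.
apply: (@addrI _ (\int[N]_(s in D) ((1 + p s) / 2))); rewrite -ND.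
rewrite -[LHS]mul1r -Rintegral_cst//.
have iD : N.-integrable D (EFin \o (fun s => (1 + p s) / 2)).
  exact: integrableS mean_integrable.
have i1 : N.-integrable D (EFin \o (cst 1 : R -> R)).
  exact: finite_measure_integrable_cst.
have -> : \int[N]_(s in D) ((1 - p s) / 2) =
    \int[N]_(s in D) (1 - (1 + p s) / 2).
  by apply: eq_Rintegral => s _; field.
by rewrite (RintegralB mD i1 iD) addrCA subrr addr0.
Qed.

End HalfLine.

(** The odd moments of q determine the signed measure s q(s) dN, which is therefore
    0, and the value of q at 0 is prescribed. *)
Lemma half_line_vanish (N : {finite_measure set MR -> \bar R}) r (q : R -> R) :
  0 < r -> N [set s | r <= `|s|] = 0%E -> N [set s | s < 0] = 0%E ->
  measurable_fun setT (q : MR -> R) -> q 0 = 0 ->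
  {ae N, forall s : MR, 0 <= (s : R) -> `|q s| <= 1} ->
  (forall k, \int[N]_(s in `[0, +oo[) (s ^+ k.*2.+1 * q s) = 0) ->
  forall D : set MR, measurable D -> D `<=` `[0, +oo[ ->
    \int[N]_(s in D) q s = 0.
Proof.
move=> r0 Nr Nneg mq q0 q1 mom D mD DI.
have i0 : N.-integrable setT (EFin \o (cst 0 : R -> R)).
  exact: finite_measure_integrable_cst.
have isq := id_density_integrable r0 Nr Nneg mq q1.
have sq0 : ae_eq N D (EFin \o (fun s => s * q s)) (EFin \o cst 0).
  apply: integral_ae_eq => //.
  - exact: integrableS isq.
  - exact/measurable_EFinP.
  - move=> B BD mB.
    have := half_line_moments_determine r0 Nr Nr i0 isq _ mB (subset_trans BD DI).
    rewrite Rintegral_cst//; last exact: measurable_norm_preimage.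
    rewrite mul0r => B0; rewrite -[LHS]fineK; last first.
      by apply: integrable_fin_num => //; exact: integrableS isq.
    rewrite [RHS]integral0; congr EFin; apply/esym/B0 => k.
    under eq_Rintegral do rewrite mulr0.
    rewrite Rintegral_cst// mul0r -[LHS](mom k).
    by apply: eq_Rintegral => s _; rewrite mulrA -exprSr.
rewrite -[RHS](mul0r (fine (N D))) -Rintegral_cst// /Rintegral; congr fine.
apply: ae_eq_integral => //.
- by apply/measurable_EFinP; exact: measurable_funTS.
- apply: filterS sq0 => s /= sqs Ds; congr EFin.
  have [] := sqs Ds; have [->|s0] := eqVneq s 0; first by [].
  by move/eqP; rewrite mulf_eq0 (negbTE s0) => /eqP.
Qed.

End EvenMoments.

(** * The spectral measure in terms of the spectral data *)

Section Transfer.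
Variable R : realType.
Notation MR := (measurableTypeR R).
Implicit Types (D : set MR) (x y : l2 R).

Lemma spectral_measure_ofE (E : pvm R) v (m : {measure set MR -> \bar R}) D :
  is_spectral_measure_of E v m -> measurable D -> m D = pvm_measure E v D.
Proof.
move=> mE mD; have [fin mDE] := mE D mD; rewrite pvm_measureE// -mDE.
by rewrite fineK.
Qed.

Lemma eq_measure_integrable (m1 m2 : {measure set MR -> \bar R}) D (f : MR -> \bar R) :
  (forall B, measurable B -> m1 B = m2 B) -> m1.-integrable D f ->
  m2.-integrable D f.
Proof.
move=> m12 /integrableP[mf foo]; apply/integrableP; split => //.
rewrite (@eq_measure_integral _ _ _ D m1 m2)// => B mB _.
by rewrite m12.
Qed.

Lemma eq_measure_Rintegral (m1 m2 : {measure set MR -> \bar R}) D (f : R -> R) :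
  (forall B, measurable B -> m1 B = m2 B) ->
  \int[m1]_(s in D) f s = \int[m2]_(s in D) f s.
Proof.
move=> m12; rewrite /Rintegral; congr fine.
by apply: eq_measure_integral => B mB _; exact: m12.
Qed.

Lemma abs_iter_double (J P : l2 R -> l2 R) : is_abs_operator J P -> adjoint J J ->
  forall k x, iter k.*2 P x = iter k.*2 J x.
Proof.
move=> [_ _ [Js JJs PP]] symJ.
have JsE x : Js x = J x by apply: inner_inj => z; rewrite -JJs -symJ.
by elim=> [//|k IH] x; rewrite doubleS !iterS IH PP JsE.
Qed.

Lemma continuous_real_complex : continuous ((fun s : R => s%:C) : R -> R[i]^o).
Proof.
move=> s; apply/(@cvgrPdist_lt R[i] R[i]^o) => e e0.
have eE : e = (Re e)%:C by case: e e0 => u w; rewrite ltcE /= => /andP[/eqP ->].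
have e0' : 0 < Re e by move: e0; rewrite ltcE /= => /andP[].
near=> t; rewrite eE normc_def /= subrr expr0n addr0 sqrtr_sqr ltcR.
near: t; exact: cvgr_dist_lt.
Unshelve. all: by end_near.
Qed.

Lemma continuous_monomial k : continuous ((fun s : R => (s ^+ k)%:C) : R -> R[i]^o).
Proof.
move=> s; apply: (@continuous_comp R R R[i]^o (fun s => s ^+ k) (fun s => s%:C)).
  exact: exprn_continuous.
exact: continuous_real_complex.
Qed.

Lemma real_complexM (x y : R) : (x * y)%:C = x%:C * y%:C :> R[i].
Proof. by simpc. Qed.

Lemma normc_Re (z : R[i]) : `|Re z| <= normc z.
Proof.
by case: z => u v /=; rewrite -sqrtr_sqr ler_wsqrtr// lerDl sqr_ge0.
Qed.

Lemma normc_Im (z : R[i]) : `|Im z| <= normc z.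
Proof.
by case: z => u v /=; rewrite -sqrtr_sqr ler_wsqrtr// lerDr sqr_ge0.
Qed.

Lemma half_complex (z : R[i]) : z / 2 = (Re z / 2) +i* (Im z / 2).
Proof.
have -> : z / 2 = (2^-1)%:C * z by rewrite mulrC fmorphV rmorph_nat.
by case: z => u v; rewrite /= /GRing.mul /= !mul0r subr0 addr0 ![_^-1 * _]mulrC.
Qed.

End Transfer.

Section Moments.
Variables (R : realType) (J P : l2 R -> l2 R) (EJ E : pvm R) (v : l2 R).
Notation MR := (measurableTypeR R).
Hypotheses (JE : spectral_resolution J EJ) (PE : spectral_resolution P E)
  (JP : is_abs_operator J P).
Notation M := (pvm_measure EJ v).
Notation N := (pvm_measure E v).

Lemma abs_even_moments k : \int[M]_s (s ^+ k.*2) = \int[N]_s (s ^+ k.*2).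
Proof.
have [_ mJ] := spectral_moment JE k.*2 v; have [_ mP] := spectral_moment PE k.*2 v.
apply: (@complexI R); rewrite -mJ -mP (abs_iter_double JP)//.
exact: spectral_adjoint JE.
Qed.

(** On even powers P may be replaced by J, so the identity that defines psi, for
    f(s) = s ^+ k.*2, computes the odd moments of J. *)
Lemma abs_odd_moments (nu : {measure set MR -> \bar R}) (psi : R -> R[i]) :
  is_spectral_measure_of E v nu ->
  (forall (f : R -> R[i]) (T : l2 R -> l2 R), continuous (f : R -> R[i]^o) ->
     is_pvm_integral E f T ->
     inner (J (T v)) v = Cintegral nu `[0, +oo[ (fun s => s%:C * f s * psi s)) ->
  forall k,
    \int[M]_s (s ^+ k.*2.+1) =
      \int[N]_(s in `[0, +oo[) (s ^+ k.*2.+1 * Re (psi s)) /\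
    \int[N]_(s in `[0, +oo[) (s ^+ k.*2.+1 * Im (psi s)) = 0.
Proof.
move=> nuE psiE k.
have := psiE _ _ (@continuous_monomial R k.*2) (spectral_integral_monomial PE k.*2).
have [_ mJ] := spectral_moment JE k.*2.+1 v.
rewrite (abs_iter_double JP); last exact: spectral_adjoint JE.
rewrite -[J _]/(iter k.*2.+1 J v) mJ /Cintegral => -[re im].
have nuN B : measurable B -> nu B = N B by exact: spectral_measure_ofE.
have mulE (s : R) : s%:C * (s ^+ k.*2)%:C = (s ^+ k.*2.+1)%:C.
  by rewrite exprS real_complexM.
split.
  rewrite re (eq_measure_Rintegral _ _ nuN); apply: eq_Rintegral => s _.
  by rewrite mulE cReM /= mul0r subr0.
rewrite [RHS]im (eq_measure_Rintegral _ _ nuN); apply: eq_Rintegral => s _.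
by rewrite mulE cImM /= mul0r addr0.
Qed.

End Moments.

Theorem theorem2p7 (R : realType) (a b : nat -> R[i])
  (a_gt0 : forall j, 0 < a j)
  (b_real : forall j, b j \is Num.real)
  (ab_bounded : bounded_params a b)
  (mu nu : {measure set (measurableTypeR R) -> \bar R})
  (psi : R -> R[i])
  (mu_spectral : is_spectral_measure (jacobi a b) (delta R 0) mu)
  (nu_psi_data : is_spectral_data (jacobi a b) nu psi) :
  has_density_on `[0, +oo[ mu nu (fun s => (1 + psi s) / 2) /\
  has_density_on `]0, +oo[ (reflected mu) nu (fun s => (1 - psi s) / 2).
Proof.
have [EJ JE muE] := mu_spectral.
have [P [E [JP PE nuE [[mre mim] psi0 psi1 psiE]]]] := nu_psi_data.
set v := delta R 0 in muE nuE psiE.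
pose M : {finite_measure set (measurableTypeR R) -> \bar R} := pvm_measure EJ v.
pose N : {finite_measure set (measurableTypeR R) -> \bar R} := pvm_measure E v.
have muM D : measurable D -> mu D = M D by exact: spectral_measure_ofE.
have nuN D : measurable D -> nu D = N D by exact: spectral_measure_ofE.
have Nnu D : measurable D -> N D = nu D by move=> mD; rewrite nuN.
have [rM rM0 MrM] := spectral_bounded_support JE.
have [rN rN0 NrN] := spectral_bounded_support PE.
pose r := Num.max rM rN.
have r0 : 0 < r by rewrite lt_max rM0.
have Mr : M [set s | r <= `|s|] = 0%E.
  apply: subset_measure0 (MrM v); try exact: measurable_norm_ge.
  by move=> s /=; apply: le_trans; rewrite le_max lexx.
have Nr : N [set s | r <= `|s|] = 0%E.
  apply: subset_measure0 (NrN v); try exact: measurable_norm_ge.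
  by move=> s /=; apply: le_trans; rewrite le_max lexx orbT.
have Nneg : N [set s | s < 0] = 0%E.
  by apply: (spectral_positive_support PE); have [_ ? _] := JP.
have even k := abs_even_moments v JE PE JP k.
have odd k := abs_odd_moments JE PE JP nuE psiE k.
have N1 : {ae N, forall s : measurableTypeR R,
    0 <= (s : R) -> normc (psi s) <= 1}.
  by have [S [mS S0 PS]] := psi1; exists S; split => //; rewrite -nuN.
have re1 : {ae N, forall s : measurableTypeR R,
    0 <= (s : R) -> `|Re (psi s)| <= 1}.
  by apply: filterS N1 => s /[apply]; apply: le_trans; exact: normc_Re.
have im1 : {ae N, forall s : measurableTypeR R,
    0 <= (s : R) -> `|Im (psi s)| <= 1}.
  by apply: filterS N1 => s /[apply]; apply: le_trans; exact: normc_Im.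
have re0 : Re (psi 0) = 1 by rewrite psi0.
have im0 : Im (psi 0) = 0 by rewrite psi0.
have imN (D : set (measurableTypeR R)) : measurable D -> D `<=` `[0, +oo[ ->
    \int[N]_(s in D) Im (psi s) = 0.
  move=> mD DI; apply: (half_line_vanish r0 Nr Nneg mim im0 im1) => // k.
  by have [] := odd k.
have iim := density_integrable Nneg mim im1.
have imean := mean_integrable Nneg mre re1.
(* Both formulas have real part c, and imaginary part a multiple of Im psi, whose
   integral vanishes. *)
have density (D : set (measurableTypeR R)) (x : R) (g : R -> R[i])
    (c : R -> R) (e : R) : measurable D -> D `<=` `[0, +oo[ ->
    (forall s, g s = c s +i* (e * Im (psi s))) ->
    N.-integrable setT (EFin \o c) -> x = \int[N]_(s in D) c s ->
    Cintegrable nu D g /\ x%:C = Cintegral nu D g.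
  move=> mD DI gE ic xE.
  have icD : N.-integrable D (EFin \o c) by exact: integrableS ic.
  have iiD : N.-integrable D (EFin \o (fun s => Im (psi s))).
    exact: integrableS iim.
  split; first split.
  - by apply: (eq_measure_integrable Nnu); under eq_fun do rewrite gE.
  - apply: (eq_measure_integrable Nnu).
    rewrite (_ : (fun _ => _) =
        (fun s : R => e%:E * (EFin \o (fun s => Im (psi s))) s)%E).
      exact: integrableZl.
    by apply/funext => s; rewrite gE.
  rewrite /Cintegral; congr (_ +i* _).
    rewrite xE (eq_measure_Rintegral _ _ nuN).
    by apply: eq_Rintegral => s _; rewrite gE.
  rewrite (eq_measure_Rintegral _ _ nuN).
  transitivity (\int[N]_(s in D) (e * Im (psi s))).
    by rewrite RintegralZl// imN// mulr0.
  by apply: eq_Rintegral => s _; rewrite gE.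
split=> D mD DI.
  have [iD eqD] : Cintegrable nu D (fun s => (1 + psi s) / 2) /\
      (fine (mu D))%:C = Cintegral nu D (fun s => (1 + psi s) / 2).
    apply: (density _ _ _ (fun s => (1 + Re (psi s)) / 2) 2^-1) => //.
      move=> s; rewrite half_complex cReD cImD; congr (_ +i* _).
      by rewrite /= add0r mulrC.
    rewrite muM//.
    apply: half_line_density_nonneg r0 Mr Nr Nneg even _ mre re0 re1 _ _ mD DI.
    by move=> k; have [] := odd k.
  by split => //; rewrite muM//; exact: fin_num_measure.
have DI' : D `<=` `[0, +oo[.
  by move=> s /DI /=; rewrite !in_itv/= !andbT => /ltW.
have mop : measurable ([set - x | x in D] : set (measurableTypeR R)).
  exact: measurable_opp_image.
have imean' : N.-integrable setT (EFin \o (fun s => (1 - Re (psi s)) / 2)).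
  have -> : EFin \o (fun s => (1 - Re (psi s)) / 2) =
      ((EFin \o cst 1%R) \- (EFin \o (fun s => (1 + Re (psi s)) / 2)%R))%E.
    by apply/funext => s /=; rewrite -EFinB; congr EFin; field.
  by apply: integrableB => //; exact: finite_measure_integrable_cst.
have [iD eqD] : Cintegrable nu D (fun s => (1 - psi s) / 2) /\
    (fine (reflected mu D))%:C = Cintegral nu D (fun s => (1 - psi s) / 2).
  apply: (density _ _ _ (fun s => (1 - Re (psi s)) / 2) (- 2^-1)) => //.
    move=> s; rewrite half_complex cReD cImD cReN cImN; congr (_ +i* _).
    by rewrite /= add0r mulrC mulrN mulNr.
  rewrite /reflected muM//.
  apply: half_line_density_neg r0 Mr Nr Nneg even _ mre re1 _ _ mD DI.
  by move=> k; have [] := odd k.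
by split => //; rewrite /reflected muM//; exact: fin_num_measure.
Qed.
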